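(* Consider the Markov switching vector autoregressive model SVAR(1) (defined in the context) with regime chain $\{I_n\}$ irreducible and aperiodic on $\{1,\dots,r\}$, and assume $\mathbb{E}\max(\log\|\varepsilon_{1i}\|,0)<\infty$ for $i=1,\dots,r$. Let $\lambda$ be the top Lyapunov exponent of $\{A_n\}$ computed when $I_0$ has the stationary distribution of the chain, i.e. $\lambda=\lim_{n\to\infty}\frac1n\log\|A_n\cdots A_1\|$ almost surely, and assume $\lambda<0$. For an arbitrary random initial vector $X_0\in\mathbb{R}^p$ and an arbitrary initial distribution of $I_0$, let $X_n=X_n(X_0,I_0)$, $n\ge1$, be defined recursively by $X_n=A_nX_{n-1}+E_n$. Then $X_n(X_0,I_0)$ converges in distribution as $n\to\infty$, and the limiting distribution is the same for all choices of the initial vector $X_0$ and of the initial distribution of $I_0$. *)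

(* Defs.v *)
From HB Require Import structures.
From mathcomp Require Import all_boot all_order all_algebra.
From mathcomp Require Import all_classical all_reals all_analysis.

Set Implicit Arguments.
Unset Strict Implicit.
Unset Printing Implicit Defensive.

Import Order.TTheory GRing.Theory Num.Theory.
Import numFieldNormedType.Exports.

Local Open Scope classical_set_scope.
Local Open Scope ring_scope.

Section SVAR.
Variable R : realType.

Fixpoint mxpow (r : nat) (Q : 'M[R]_r) (n : nat) : 'M[R]_r :=
  if n is n'.+1 then Q *m mxpow Q n' else 1%:M.

Definition stochastic (r : nat) (Q : 'M[R]_r) : Prop :=
  (forall i j, 0 <= Q i j) /\ (forall i, \sum_j Q i j = 1).

Definition prob_vector (r : nat) (mu : 'I_r -> R) : Prop :=
  (forall i, 0 <= mu i) /\ \sum_i mu i = 1.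

Definition irreducible (r : nat) (Q : 'M[R]_r) : Prop :=
  forall i j, exists n : nat, 0 < mxpow Q n i j.

Definition aperiodic (r : nat) (Q : 'M[R]_r) : Prop :=
  forall i (d : nat),
    (forall n : nat, (0 < n)%N -> 0 < mxpow Q n i i -> (d %| n)%N) -> d = 1%N.

Definition stationary (r : nat) (Q : 'M[R]_r) (pi : 'I_r -> R) : Prop :=
  prob_vector pi /\ forall j, pi j = \sum_i pi i * Q i j.

Definition borel_mx (m n : nat) : set (set 'M[R]_(m, n)) :=
  <<s [set U : set 'M[R]_(m, n) | open U] >>.

Definition elog (x : R) : \bar R := if x == 0 then -oo%E else (ln x)%:E.

Fixpoint mprod (r p : nat) (alpha : 'I_r -> 'M[R]_p) (J : nat -> 'I_r) (n : nat)
  : 'M[R]_p :=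
  if n is n'.+1 then alpha (J n) *m mprod alpha J n' else 1%:M.

(* X_0 given, X_n = A_n X_{n-1} + E_n, with A_n = alpha_{I_n}, E_n = eps_{n, I_n}
   (column I_n of the p x r matrix eps_n = (eps_{n1}, ..., eps_{nr})) *)
Fixpoint Xseq (r p : nat) (alpha : 'I_r -> 'M[R]_p) (J : nat -> 'I_r)
  (eps : nat -> 'M[R]_(p, r)) (x0 : 'cV[R]_p) (n : nat) : 'cV[R]_p :=
  if n is n'.+1 then alpha (J n) *m Xseq alpha J eps x0 n' + col (J n) (eps n)
  else x0.

Section Prob.
Context {d : measure_display} {T : measurableType d} (P : probability T R).

Definition random_mx (m n : nat) (X : T -> 'M[R]_(m, n)) : Prop :=
  forall i j, measurable_fun setT (fun t => X t i j).

Definition markov_chain (r : nat) (mu0 : 'I_r -> R) (Q : 'M[R]_r)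
  (I : nat -> T -> 'I_r) : Prop :=
  (forall n i, measurable [set t | I n t = i]) /\
  forall (n : nat) (s : nat -> 'I_r),
    P [set t | forall k, (k <= n)%N -> I k t = s k] =
    (mu0 (s 0%N) * \prod_(k < n) Q (s k) (s k.+1))%:E.

(* eps_1, eps_2, ... (each a p x r random matrix, column i = eps_{n i}) are
   i.i.d. with law nu and independent of the chain {I_n}: the joint law of
   (I_0, ..., I_m, eps_1, ..., eps_n) is the product law *)
Definition iid_indep_noise (r p : nat) (I : nat -> T -> 'I_r)
  (eps : nat -> T -> 'M[R]_(p, r)) (nu : set 'M[R]_(p, r) -> R) : Prop :=
  (forall n B, borel_mx B -> measurable (eps n @^-1` B)) /\
  forall (m : nat) (s : nat -> 'I_r) (n : nat) (B : nat -> set 'M[R]_(p, r)),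
    (forall k, borel_mx (B k)) ->
    P ([set t | forall k, (k <= m)%N -> I k t = s k] `&`
       [set t | forall k, (1 <= k <= n)%N -> B k (eps k t)]) =
    (P [set t | forall k, (k <= m)%N -> I k t = s k] *
     (\prod_(1 <= k < n.+1) nu (B k))%:E)%E.

End Prob.

Definition bcont (p : nat) (f : 'cV[R]_p -> R) : Prop :=
  continuous f /\ exists M : R, forall x, `|f x| <= M.

End SVAR.

(* Main.v *)
Require Import Defs.
From HB Require Import structures.
From mathcomp Require Import all_boot all_order all_algebra.
From mathcomp Require Import all_classical all_reals all_analysis.
From mathcomp Require Import measurable_realfun.
From mathcomp Require Import zify ring lra.

Set Implicit Arguments.
Unset Strict Implicit.
Unset Printing Implicit Defensive.

Import Order.TTheory GRing.Theory Num.Theory.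
Import numFieldNormedType.Exports.

Local Open Scope classical_set_scope.
Local Open Scope ring_scope.

(* The Lyapunov hypothesis makes |A_n ... A_1| smaller than exp(-c n) with probability
   close to 1; hence E |A_m ... A_1|^(1/m) < 1 for some m, and by submultiplicativity
   |A_n ... A_1| exceeds tau^n with geometrically small probability, from any initial
   regime.  Such bounds depend only on finite path probabilities, so they survive time
   reversal.  Let J be a stationary chain with the reversed kernel, independent of the
   noise eps'.  In stationarity X_n started at 0 has the law of
     sum_(m < n) alpha(J_0) ... alpha(J_(m-1)) eps'_(m+1, J_m),
   which converges almost surely to some Y, because E log^+ |eps_1i| < oo.
   For general X_0 and I_0, restart X from 0 at a late time N: the error tends to 0 with
   A_n ... A_(N+1), and the law of I_N is close to the stationary one, so that the path
   laws have a density with respect to the stationary ones that is close to 1. *)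

(** * Ergodicity of finite Markov chains *)

(** Forward in time X_n never settles along a path, since each new noise enters with full weight. In
    reversed time a new term stands behind the whole product and is damped, so convergence in law
    can be read off from almost sure convergence of another sequence. The obstacle is that the
    Lyapunov hypothesis concerns forward products. For each n separately, the backward product
    [bprod] has the law of a forward one, but the sequences have different joint laws, so an almost
    sure rate does not pass from one to the other. Bounds on probabilities that are summable in n
    do, by Borel-Cantelli. Positivity of pi enters twice: a bound for the stationary start becomes
    one for every fixed start, and the density of a path law with respect to the stationary one is
    the ratio of the initial masses, so the comparison error does not grow with n. The data fix only
    finite-dimensional laws, so processes on different spaces are compared through functionals of
    finitely many regimes and noises. *)

Lemma semigroup_cofinite (S : nat -> Prop) :
  (forall m n, S m -> S n -> S (m + n)%N) ->
  (forall d, (forall n, (0 < n)%N -> S n -> (d %| n)%N) -> d = 1%N) ->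
  exists N, forall n, (N <= n)%N -> S n.
Proof.
move=> SD Sgcd; pose S0 n := n = 0%N \/ S n.
have S0D m n : S0 m -> S0 n -> S0 (m + n)%N.
  move=> [->|Sm] [->|Sn]; rewrite /S0 ?addn0 ?add0n; [by left|by right|by right|].
  by right; exact: SD.
have S0M k n : S0 n -> S0 (k * n)%N.
  by move=> Sn; elim: k => [|k IH]; [left|rewrite mulSn; exact: S0D].
(* [D d] says that d is a positive difference of two elements of S together with 0. The least such d
   divides every n in S, as otherwise [n %% d] would be a smaller one; hence it is 1. *)
pose D := fun d => `[< (0 < d)%N /\ exists b, S0 b /\ S0 (b + d)%N >].
have exD : exists d, D d.
  apply: contrapT => nD.
  (* Without a positive element, S would satisfy the divisibility condition for 2. *)
  suff /Sgcd : forall n, (0 < n)%N -> S n -> (2 %| n)%N by [].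
  move=> n n0 Sn; exfalso; apply: nD; exists n.
  by apply/asboolP; split=> //; exists 0%N; split; [left|right].
case: (ex_minnP exD) => d /asboolP[d0 [b [Sb Sbd]]] dmin.
have d1 : d = 1%N.
  apply: Sgcd => n n0 Sn; rewrite /dvdn; apply/negPn/negP => nz.
  have /dmin : D (n %% d)%N.
    apply/asboolP; split; first by rewrite lt0n.
    exists ((n %/ d) * (b + d))%N; split; first exact: S0M.
    have -> : (n %/ d * (b + d) + n %% d = n + n %/ d * b)%N.
      by rewrite mulnDr -addnA -divn_eq addnC.
    by apply: S0D; [right|exact: S0M].
  by rewrite leqNgt ltn_mod d0.
exists (b * b).+1 => n bn; move: Sbd; rewrite d1 addn1 => Sb1.
suff [n0|//] : S0 n by rewrite n0 in bn.
case: (posnP b) => b0.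
  by rewrite -(muln1 n); apply: S0M; rewrite b0 in Sb1.
have rb : (n %% b < b)%N by rewrite ltn_mod.
have bq : (b <= n %/ b)%N by rewrite leq_divRL // ltnW.
(* The consecutive b and b + 1 generate n: as n > b * b, there are enough copies of b in n to turn
   [n %% b] of them into b + 1. *)
have -> : n = ((n %/ b - n %% b) * b + n %% b * b.+1)%N.
  rewrite {1}(divn_eq n b) mulnS [(n %% b + _)%N]addnC addnA -mulnDl subnK //.
  exact: leq_trans (ltnW rb) bq.
by apply: S0D; exact: S0M.
Qed.

Section FiniteChain.
Context {R : realType} {r : nat}.
Implicit Types (Q : 'M[R]_r) (mu : 'I_r -> R).

Lemma mxpowD Q m n : mxpow Q (m + n) = mxpow Q m *m mxpow Q n.
Proof. by elim: m => [|m IH] /=; rewrite ?mul1mx // IH mulmxA. Qed.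

Lemma stochastic_mul Q Q' : stochastic Q -> stochastic Q' -> stochastic (Q *m Q').
Proof.
move=> [Q0 Q1] [Q'0 Q'1]; split=> [i j|i].
  by rewrite mxE sumr_ge0 // => k _; exact: mulr_ge0.
under eq_bigr do rewrite mxE.
rewrite exchange_big /= -[RHS](Q1 i); apply: eq_bigr => k _.
by rewrite -mulr_sumr Q'1 mulr1.
Qed.

Lemma stochastic_mxpow Q n : stochastic Q -> stochastic (mxpow Q n).
Proof.
move=> sQ; elim: n => [|n IH] /=; last exact: stochastic_mul.
split=> [i j|i]; first by rewrite mxE; case: eqP.
rewrite (bigD1 i) //= mxE eqxx big1 ?addr0 // => j ji.
by rewrite mxE eq_sym (negbTE ji).
Qed.

Lemma mxpow_gt0_trans Q m n i j k : stochastic Q ->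
  0 < mxpow Q m i j -> 0 < mxpow Q n j k -> 0 < mxpow Q (m + n) i k.
Proof.
move=> sQ ij jk; rewrite mxpowD mxE (bigD1 j) //=.
rewrite ltr_wpDr //; last exact: mulr_gt0.
apply: sumr_ge0 => l _; apply: mulr_ge0.
  by have [+ _] := stochastic_mxpow m sQ; apply.
by have [+ _] := stochastic_mxpow n sQ; apply.
Qed.

(** The return times to i form an additive semigroup of gcd 1, so they contain all large times. A
    long return to i followed by one fixed path from i to j then has any prescribed large length. *)
Lemma mxpow_gt0 Q : stochastic Q -> irreducible Q -> aperiodic Q ->
  exists N, forall n i j, (N <= n)%N -> 0 < mxpow Q n i j.
Proof.
move=> sQ irr aper.
have ret i : exists N, forall n, (N <= n)%N -> 0 < mxpow Q n i i.
  apply: semigroup_cofinite; last exact: aper.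
  by move=> m n; exact: mxpow_gt0_trans.
have [N HN] := choice ret.
have pth (ij : 'I_r * 'I_r) : exists n, 0 < mxpow Q n ij.1 ij.2 by exact: irr.
have [L HL] := choice pth.
exists (\max_i N i + \max_ij L ij)%N => n i j le.
have lL : (L (i, j) <= \max_ij L ij)%N by exact: leq_bigmax.
have lN : (N i <= \max_i N i)%N by exact: leq_bigmax.
rewrite -(@subnK (L (i, j)) n); last by lia.
by apply: (mxpow_gt0_trans sQ) (HL (i, j)); apply: HN; lia.
Qed.

Let nrm1 (v : 'rV[R]_r) := \sum_j `|v 0 j|.

(* As v sums to 0, subtracting delta from every entry of Q does not change v *m Q. *)
Lemma nrm1_contract Q (delta : R) (v : 'rV[R]_r) :
  stochastic Q -> (forall i j, delta <= Q i j) -> \sum_i v 0 i = 0 ->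
  nrm1 (v *m Q) <= (1 - r%:R * delta) * nrm1 v.
Proof.
move=> [_ Q1] dQ v0.
have E j : (v *m Q) 0 j = \sum_i v 0 i * (Q i j - delta).
  rewrite mxE; under [RHS]eq_bigr do rewrite mulrBr.
  by rewrite sumrB -mulr_suml v0 mul0r subr0.
rewrite /nrm1; under eq_bigr do rewrite E.
apply: (@le_trans _ _ (\sum_j \sum_i `|v 0 i| * (Q i j - delta))).
  apply: ler_sum => j _; apply: (le_trans (ler_norm_sum _ _ _)).
  apply: ler_sum => i _; rewrite normrM [X in _ * X <= _]ger0_norm //.
  by rewrite subr_ge0.
rewrite exchange_big /= mulr_sumr ler_sum // => i _.
rewrite -mulr_sumr sumrB Q1 sumr_const card_ord mulrC.
by rewrite mulr_natl.
Qed.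

Definition mstep Q mu : 'I_r -> R := fun j => \sum_i mu i * Q i j.

Lemma mstep_prob Q mu : stochastic Q -> prob_vector mu -> prob_vector (mstep Q mu).
Proof.
move=> [Q0 Q1] [m0 m1]; split=> [j|].
  by apply: sumr_ge0 => i _; exact: mulr_ge0.
rewrite /mstep exchange_big -m1; apply: eq_bigr => i _ /=.
by rewrite -mulr_sumr Q1 mulr1.
Qed.

Lemma iter_mstep_prob Q mu n :
  stochastic Q -> prob_vector mu -> prob_vector (iter n (mstep Q) mu).
Proof. by move=> sQ pm; elim: n => //= n; exact: mstep_prob. Qed.

Lemma iter_mstepE Q mu n :
  \row_j iter n (mstep Q) mu j = (\row_j mu j) *m mxpow Q n.
Proof.
elim: n => [|n IH] /=; first by rewrite mulmx1.
have -> : Q *m mxpow Q n = mxpow Q n *m Q.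
  by have := mxpowD Q n 1; rewrite addn1 /= mulmx1.
by rewrite mulmxA -IH; apply/rowP => j; rewrite !mxE; apply: eq_bigr => i _; rewrite mxE.
Qed.

(** Doeblin's argument: a power of Q with all entries at least delta contracts the l1 norm by c < 1
    on vectors of sum 0. This makes every initial law converge, and it also shows that a fixed row
    vector has nonzero sum and can be normalised. *)
Lemma markov_limit Q (i0 : 'I_r) : stochastic Q -> irreducible Q -> aperiodic Q ->
  exists pi : 'I_r -> R, [/\ stationary Q pi, forall i, 0 < pi i &
    forall mu, prob_vector mu ->
      forall j, iter n (mstep Q) mu j @[n --> \oo] --> pi j].
Proof.
move=> sQ irr aper; have [N0 HN0] := mxpow_gt0 sQ irr aper.
pose N := N0.+1.
have HN n i j : (N <= n)%N -> 0 < mxpow Q n i j by move=> h; apply: HN0; exact: ltnW.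
pose delta := \big[Num.min/1]_i \big[Num.min/1]_j mxpow Q N i j.
have d0 : 0 < delta.
  by apply: lt_bigmin => // i _; apply: lt_bigmin => // j _; exact: HN.
have dQ i j : delta <= mxpow Q N i j.
  by apply: bigmin_inf => //; exact: bigmin_le.
pose c := 1 - r%:R * delta.
have r0 : 0 < r%:R :> R by rewrite ltr0n (leq_ltn_trans _ (ltn_ord i0)).
have c1 : c < 1 by rewrite /c ltrBlDr ltrDl mulr_gt0.
have sN := stochastic_mxpow N sQ.
have c0 : 0 <= c.
  rewrite /c subr_ge0 -[leRHS](sN.2 i0) mulr_natl -{1}(card_ord r) -sumr_const.
  by apply: ler_sum => j _.
have sum_mul (v : 'rV[R]_r) (P : 'M[R]_r) : stochastic P -> \sum_i (v *m P) 0 i = \sum_i v 0 i.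
  move=> [_ P1]; under eq_bigr do rewrite mxE.
  by rewrite exchange_big /=; apply: eq_bigr => i _; rewrite -mulr_sumr P1 mulr1.
have n1_le (v : 'rV[R]_r) (P : 'M[R]_r) : stochastic P -> nrm1 (v *m P) <= nrm1 v.
  move=> [P0 P1]; rewrite /nrm1; under eq_bigr do rewrite mxE.
  apply: (@le_trans _ _ (\sum_j \sum_i `|v 0 i| * P i j)).
    apply: ler_sum => j _; apply: (le_trans (ler_norm_sum _ _ _)).
    by apply: ler_sum => i _; rewrite normrM [X in _ * X <= _]ger0_norm.
  by rewrite exchange_big /= ler_sum // => i _; rewrite -mulr_sumr P1 mulr1.
have n1_0 v : 0 <= nrm1 v by apply: sumr_ge0.
have decay k (v : 'rV[R]_r) : \sum_i v 0 i = 0 ->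
    nrm1 (v *m mxpow Q (k * N)) <= c ^+ k * nrm1 v.
  move=> v0; elim: k => [|k IH]; first by rewrite mul0n /= mulmx1 expr0 mul1r.
  rewrite mulSnr mxpowD mulmxA exprS -mulrA.
  apply: (le_trans (nrm1_contract sN dQ _)); last exact: ler_wpM2l.
  by rewrite sum_mul //; exact: stochastic_mxpow.
have decay' n (v : 'rV[R]_r) : \sum_i v 0 i = 0 ->
    nrm1 (v *m mxpow Q n) <= c ^+ (n %/ N) * nrm1 v.
  move=> v0; rewrite {1}(divn_eq n N) mxpowD mulmxA.
  by apply: (le_trans (n1_le _ _ (stochastic_mxpow _ sQ))); exact: decay.
have cvg0 (v : 'rV[R]_r) j : \sum_i v 0 i = 0 ->
    (v *m mxpow Q n) 0 j @[n --> \oo] --> 0.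
  move=> v0; apply/norm_cvg0P.
  have : c ^+ (n %/ N) * nrm1 v @[n --> \oo] --> 0.
    rewrite -(mul0r (nrm1 v)); apply: cvgMl => //.
    have : c ^+ n @[n --> \oo] --> 0 by apply: cvg_expr; rewrite ger0_norm.
    move/cvgrPdist_lt => H; apply/cvgrPdist_lt => e e0.
    have [K _ HK] := H e e0; exists (K * N)%N => // n /= Kn; apply: HK => /=.
    by rewrite leq_divRL.
  apply: squeeze_cvgr; last exact: cvg_cst.
  near=> n; rewrite normr_ge0 /=; apply: le_trans (decay' n v v0).
  by rewrite /nrm1 (bigD1 j) //= lerDl sumr_ge0.
(* The rows of Q sum to 1, so Q - 1 kills the constant column; being singular, it also kills some
   nonzero row. *)
have [v vn0 vQ] : exists2 v : 'rV[R]_r, v != 0 & v *m Q = v.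
  have /det0P[v v0 vQ] : \det (Q - 1%:M) == 0.
    rewrite -det_tr; apply/det0P; exists (const_mx 1).
      by apply/eqP => /rowP/(_ i0); rewrite !mxE => /eqP; rewrite oner_eq0.
    apply/rowP => j; rewrite !mxE.
    under eq_bigr do rewrite !mxE mul1r.
    rewrite sumrB sQ.2 (bigD1 j) //= eqxx big1 ?addr0 ?subrr // => i ij.
    by rewrite eq_sym (negbTE ij).
  by exists v => //; move/eqP: vQ; rewrite mulmxBr mulmx1 subr_eq0 => /eqP.
have vQn n : v *m mxpow Q n = v.
  by elim: n => [|n IH] /=; rewrite ?mulmx1 // mulmxA vQ IH.
have sv : \sum_i v 0 i != 0.
  apply/eqP => s0; case/negP: vn0; apply/eqP/rowP => j; rewrite [RHS]mxE.
  have := cvg0 v j s0; under eq_fun do rewrite vQn.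
  by move=> h; apply: (cvg_unique _ (@cvg_cst _ (v 0 j) _ _ _) h) => //.
pose w := (\sum_i v 0 i)^-1 *: v.
have sw : \sum_i w 0 i = 1.
  under eq_bigr do rewrite mxE.
  by rewrite -mulr_sumr mulVf.
have wQ n : w *m mxpow Q n = w by rewrite -scalemxAl vQn.
pose pi i := w 0 i.
have lim mu : prob_vector mu -> forall j, iter n (mstep Q) mu j @[n --> \oo] --> pi j.
  move=> [m0 m1] j.
  have z : \sum_i ((\row_j0 mu j0) - w) 0 i = 0.
    under eq_bigr do rewrite mxE [(- w) _ _]mxE mxE.
    by rewrite sumrB m1 sw subrr.
  have h n : iter n (mstep Q) mu j = (((\row_j0 mu j0) - w) *m mxpow Q n) 0 j + pi j.
    by rewrite mulmxBl -iter_mstepE wQ mxE [(- w) _ _]mxE mxE subrK.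
  under eq_fun do rewrite h.
  have := cvgD (cvg0 _ j z) (cvg_cst (pi j)); rewrite add0r; exact.
(* The sign of the eigenvector is not known beforehand. It comes from pi being a limit of
   probability vectors; strict positivity then follows from pi = pi Q^N with Q^N positive. *)
have pi_ge0 j : 0 <= pi j.
  have pd : prob_vector (fun i => (i == i0)%:R : R).
    by split=> [i|]; rewrite ?ler0n // (bigD1 i0) //= eqxx big1 ?addr0 // => i /negbTE ->.
  have L := lim _ pd j; rewrite -(cvg_lim (@Rhausdorff R) L).
  apply: limr_ge; first by apply/cvg_ex; exists (pi j).
  by apply: nearW => n; have [+ _] := iter_mstep_prob n sQ pd; apply.
have pi_gt0 j : 0 < pi j.
  have [k k0] : exists k, 0 < pi k.
    apply: contrapT => nk; have : \sum_k pi k = 0.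
      apply: big1 => k _; apply/eqP; rewrite eq_le pi_ge0 andbT leNgt.
      by apply/negP => h; apply: nk; exists k.
    by rewrite sw => /eqP; rewrite oner_eq0.
  rewrite /pi -(wQ N) mxE (bigD1 k) // ltr_pwDl //.
    by apply: mulr_gt0; [exact: k0|exact: HN].
  by apply: sumr_ge0 => i _; apply: mulr_ge0; [exact: pi_ge0|exact/ltW/HN].
exists pi; split => //; split; first by split.
move=> j; rewrite /pi -[in LHS](wQ 1) /= mulmx1 mxE; exact: eq_bigr.
Unshelve. all: end_near. Qed.
End FiniteChain.

(** * A Markov chain on the unit interval *)

Lemma path_measurable d (T : measurableType d) r (I : nat -> T -> 'I_r)
    (s : nat -> 'I_r) (n : nat) : (forall n i, measurable [set t | I n t = i]) ->
  measurable [set t | forall k, (k <= n)%N -> I k t = s k].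
Proof.
move=> mI; rewrite (_ : mkset _ = \bigcap_(k in [set k | (k <= n)%N]) [set t | I k t = s k]) //.
by apply: bigcap_measurable => //; exists 0%N.
Qed.

Section UniformChain.
Context {R : realType} {r : nat}.
Implicit Types (Q : 'M[R]_r) (mu : 'I_r -> R).

Lemma uniform_prob_itv (a b : R) : 0 <= a -> a <= b -> b <= 1 ->
  uniform_prob (@ltr01 R) `[a, b[ = (b - a)%:E.
Proof.
move=> a0 ab b1; rewrite /uniform_prob.
rewrite (eq_integral (fun=> 1%:E)); last first.
  move=> x; rewrite inE/= in_itv/= /uniform_pdf => /andP[ax xb].
  by rewrite (le_trans a0 ax) (ltW (lt_le_trans xb b1)) subr0 invr1.
rewrite integral_cst //= mul1e lebesgue_measure_itv /= lte_fin.
case: ltP => // ba; have -> : b = a by apply/le_anti; rewrite ab ba.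
by rewrite subrr.
Qed.

Lemma uniform_prob_setI01 (A : set R) : measurable A ->
  uniform_prob (@ltr01 R) A = uniform_prob (@ltr01 R) (A `&` `[0, 1[).
Proof.
move=> mA; apply/esym; rewrite -[in RHS](setIT A).
have -> : [set: R] = `[0, 1[ `|` ~` `[0, 1[ by rewrite setUv.
have z : uniform_prob (@ltr01 R) (~` `[0, 1[) = 0%E.
  rewrite probability_setC // (_ : _ `[0, 1[%classic = 1%:E) ?subee //.
  by have := @uniform_prob_itv 0 1; rewrite subr0; apply.
rewrite setIUr measureU //=; first last.
- rewrite setIACA setICr setI0 //.
- by apply: measurableI => //; exact: measurableC.
- exact: measurableI.
rewrite [X in _ = (_ + X)%E](_ : _ = 0%E) ?adde0 //.
apply: subset_measure0 z => //; first by apply: measurableI => //; exact: measurableC.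
exact: measurableC.
Qed.

Variable i0 : 'I_r.

Definition cumul mu (i : 'I_r) : R := \sum_(j < r | (j < i)%N) mu j.
(** When mu is a probability vector, exactly one letter qualifies for each u in [0, 1), never one of
    mass 0; the default [i0] is for the other u. *)
Definition quantile mu (u : R) := odflt i0 [pick i | cumul mu i <= u < cumul mu i + mu i].
Definition quantile_rest mu u := (u - cumul mu (quantile mu u)) / mu (quantile mu u).

(* Choosing a letter of law mu by its quantile function at u and rescaling the
   remainder makes the set of u with a prescribed path a subinterval of [0, 1) whose
   length is the probability of the path. *)
Fixpoint quantile_chain Q mu (u : R) (n : nat) : 'I_r :=
  if n is n'.+1 then quantile_chain Q (Q (quantile mu u)) (quantile_rest mu u) n'
  else quantile mu u.

Lemma cumul_le mu (i j : 'I_r) : prob_vector mu -> (i < j)%N -> cumul mu i + mu i <= cumul mu j.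
Proof.
move=> [m0 m1] ij.
rewrite /cumul [leRHS](bigD1 i) //= [leRHS]addrC lerD2r.
rewrite [leLHS]big_mkcond [leRHS]big_mkcond /=; apply: ler_sum => k _.
case: ifP => ki; case: ifP => // /negbT.
by rewrite (ltn_trans ki ij) /= -val_eqE /= (ltn_eqF ki).
Qed.

Lemma cumul_ge0 mu i : prob_vector mu -> 0 <= cumul mu i.
Proof. by move=> [m0 m1]; apply: sumr_ge0. Qed.

Lemma cumul_le1 mu i : prob_vector mu -> cumul mu i + mu i <= 1.
Proof.
move=> [m0 <-]; rewrite [leRHS](bigD1 i) //= [leRHS]addrC lerD2r.
rewrite [leLHS]big_mkcond [leRHS]big_mkcond /=; apply: ler_sum => k _.
case: ifP => ki; case: ifP => // /negbT.
by rewrite -val_eqE /= (ltn_eqF ki).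
Qed.

Lemma quantileP mu u i : prob_vector mu -> 0 <= u < 1 ->
  (quantile mu u = i) <-> (cumul mu i <= u < cumul mu i + mu i).
Proof.
move=> pm /andP[u0 u1].
have uniq (i' j : 'I_r) : (i' < j)%N ->
    cumul mu i' <= u < cumul mu i' + mu i' -> cumul mu j <= u < cumul mu j + mu j -> False.
  move=> ij /andP[_ h1] /andP[h2 _]; have := cumul_le pm ij.
  by move/(lt_le_trans h1)/lt_le_trans => /(_ _ h2); rewrite ltxx.
rewrite /quantile; case: pickP => [j hj|none] /=.
  split => [<-//|hi]; case: (ltngtP i j) => [h|h|/val_inj ->] //.
    by case: (uniq i j).
  by case: (uniq j i).
exfalso.
(* If u avoided all the intervals, every partial sum of mu would be at most u, and so would the
   total, which is 1. *)
suff H n : (n <= r)%N -> \sum_(j < r | (j < n)%N) mu j <= u.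
  have := H r (leqnn r); rewrite (eq_bigl xpredT) => [|j]; last exact: ltn_ord.
  by rewrite pm.2 leNgt u1.
elim: n => [_|n IH nr]; first by rewrite big_pred0.
have {}IH := IH (ltnW nr); pose j := Ordinal nr.
have := none j; rewrite {1}/cumul /= IH /= => /negbT; rewrite -leNgt; apply: le_trans.
rewrite [leLHS](bigD1 j) //= addrC lerD2r le_eqVlt; apply/orP; left; apply/eqP.
apply: eq_bigl => k; rewrite -val_eqE /= ltnS; lia.
Qed.

Lemma quantile_chain_itv Q mu (s : nat -> 'I_r) n : stochastic Q -> prob_vector mu ->
  exists a b, [/\ 0 <= a, a <= b, b <= 1,
    b - a = mu (s 0%N) * \prod_(k < n) Q (s k) (s k.+1) &
    forall u, (0 <= u < 1 /\ forall k, (k <= n)%N -> quantile_chain Q mu u k = s k)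
       <-> (a <= u < b)].
Proof.
move=> [Q0 Q1]; elim: n mu s => [|n IH] mu s pm.
  have c0 := cumul_ge0 (s 0%N) pm; have c1 := cumul_le1 (s 0%N) pm.
  exists (cumul mu (s 0%N)), (cumul mu (s 0%N) + mu (s 0%N)); split => //.
  - by rewrite lerDl pm.1.
  - by rewrite big_ord0 mulr1 addrC addKr.
  - move=> u; split.
      by move=> [u01 /(_ 0%N (leqnn _)) /=]; rewrite quantileP.
    move=> h; have u01 : 0 <= u < 1.
      by case/andP: h => h1 h2; rewrite (le_trans c0 h1) (lt_le_trans h2 c1).
    by split => // k; rewrite leqn0 => /eqP -> /=; rewrite quantileP.
(* A first letter of mass 0 has an empty interval; it is treated apart because the remainder is
   divided by that mass. *)
have [m0|mn0] := eqVneq (mu (s 0%N)) 0.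
  exists 0, 0; split => //; first by rewrite m0 mul0r subrr.
  move=> u; split.
    move=> [u01 /(_ 0%N isT) /=]; rewrite quantileP // m0 addr0 => /andP[h1 h2].
    by move: (le_lt_trans h1 h2); rewrite ltxx.
  by move=> /andP[h1 h2]; move: (le_lt_trans h1 h2); rewrite ltxx.
have m0 : 0 < mu (s 0%N) by rewrite lt_def mn0 pm.1.
have c0 := cumul_ge0 (s 0%N) pm; have c1 := cumul_le1 (s 0%N) pm.
set c := cumul mu (s 0%N) in c0 c1; set m := mu (s 0%N) in mn0 m0 c1 *.
have pQ : prob_vector (Q (s 0%N)) by split.
have [a [b [a0 ab b1 eab H]]] := IH (Q (s 0%N)) (fun k => s k.+1) pQ.
exists (c + m * a), (c + m * b); split.
- by rewrite addr_ge0 // mulr_ge0 // ltW.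
- by rewrite lerD2l ler_pM2l.
- by apply: le_trans c1; rewrite lerD2l ger_pMr.
- by rewrite opprD addrACA subrr add0r -mulrBr eab big_ord_recl /=.
move=> u.
(* Under the affine map v -> c + m v, the interval given by the induction hypothesis for the law
   [Q (s 0%N)] becomes the one sought. *)
have E : (a <= (u - c) / m < b) = (c + m * a <= u < c + m * b).
  rewrite ler_pdivlMr // ltr_pdivrMr // lerBrDl ltrBlDl.
  by rewrite (mulrC a) (mulrC b).
rewrite -E -H; split.
  move=> [u01 hk]; have /= h0 := hk 0%N isT.
  have := h0; rewrite quantileP // -/c -/m => /andP[h1 h2].
  split; last by move=> k kn; have /= := hk k.+1 kn; rewrite /quantile_rest h0.
  apply/andP; split; first by rewrite divr_ge0 ?subr_ge0 // ltW.
  by rewrite ltr_pdivrMr // mul1r ltrBlDl.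
move=> [/andP[v0 v1] hk].
have h1 : c <= u by move: v0; rewrite ler_pdivlMr // mul0r subr_ge0.
have h2 : u < c + m by move: v1; rewrite ltr_pdivrMr // mul1r ltrBlDl.
have u01 : 0 <= u < 1 by rewrite (le_trans c0 h1) (lt_le_trans h2 c1).
have e0 : quantile mu u = s 0%N by rewrite quantileP // h1 h2.
split => // -[_ //|k kn] /=; rewrite /quantile_rest e0; exact: hk.
Qed.

Lemma markov_chain_uniform Q mu : stochastic Q -> prob_vector mu ->
  exists J : nat -> R -> 'I_r, markov_chain (uniform_prob (@ltr01 R)) mu Q J.
Proof.
move=> sQ pm.
pose J n u := if 0 <= u < 1 then quantile_chain Q mu u n else i0.
have JE s n : exists a b, [/\ 0 <= a, a <= b, b <= 1,
    b - a = mu (s 0%N) * \prod_(k < n) Q (s k) (s k.+1) &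
    [set u | forall k, (k <= n)%N -> J k u = s k] `&` `[0, 1[ = `[a, b[%classic].
  have [a [b [a0 ab b1 eab H]]] := quantile_chain_itv s n sQ pm.
  exists a, b; split => //; apply/seteqP; split => u /=.
    move=> [hk]; rewrite !in_itv /= => u01; apply/H; split => // k kn.
    by rewrite -hk // /J u01.
  rewrite !in_itv /= => /H[u01 hk]; split => // k kn.
  by rewrite /J u01 hk.
have mJ n i : measurable [set u : R | J n u = i].
  (* Inside [0, 1) the event is a finite union over words, each of which contributes an interval;
     outside, J is constant. *)
  have -> : [set u : R | J n u = i] =
     (\bigcup_(s in [set s : {ffun 'I_n.+1 -> 'I_r} | s ord_max = i])
       ([set u | forall k, (k <= n)%N -> J k u = s (inord k)] `&` `[0, 1[))
     `|` ([set u | i0 = i] `&` ~` `[0, 1[).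
    apply/seteqP; split => u /=.
      move=> <-; rewrite in_itv /=; case: (boolP (0 <= u < 1)) => u01; [left|right].
        exists [ffun k : 'I_n.+1 => J k u]; first by rewrite /= ffunE.
        by split; [move=> k kn; rewrite ffunE inordK|rewrite /= in_itv].
      by split => //; rewrite /J (negbTE u01).
    case=> [[s sn [/(_ n (leqnn n)) -> _]]|[<- ]].
      by rewrite -sn; congr (s _); apply: val_inj; rewrite /= inordK.
    by rewrite in_itv /= /J => /negP/negbTE ->.
  apply: measurableU; last first.
    apply: measurableI; last exact: measurableC.
    have [e|ne] := pselect (i0 = i).
      by rewrite (_ : mkset _ = setT) //; apply/seteqP; split.
    by rewrite (_ : mkset _ = set0) //; apply/seteqP; split.
  apply: fin_bigcup_measurable => // s _.
  by have [a [b [_ _ _ _ ->]]] := JE (fun k => s (inord k)) n.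
exists J; split => // n s.
apply: eq_trans (uniform_prob_setI01 _) _; first exact: path_measurable.
have [a [b [a0 ab b1 <- ->]]] := JE s n.
exact: uniform_prob_itv.
Qed.
End UniformChain.

(** * Fractional moments of products of random matrices *)

Section MatrixNorm.
Context {R : realType}.

Lemma mx_entry_le m n (A : 'M[R]_(m, n)) i j : `|A i j| <= `|A|.
Proof. by rewrite [leRHS]mx_normrE; apply: (le_bigmax _ _ (i, j)). Qed.

Lemma mx_norm_le m n (A : 'M[R]_(m, n)) c :
  0 <= c -> (forall i j, `|A i j| <= c) -> `|A| <= c.
Proof.
move=> c0 H; rewrite [leLHS]mx_normrE; apply/bigmax_leP; split => // ij _; exact: H.
Qed.

Lemma mx_norm_mul m n k (A : 'M[R]_(m, n)) (B : 'M[R]_(n, k)) :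
  `|A *m B| <= n%:R * (`|A| * `|B|).
Proof.
apply: mx_norm_le => [|i j]; first by rewrite !mulr_ge0.
have -> : n%:R * (`|A| * `|B|) = \sum_(l < n) `|A| * `|B|.
  by rewrite sumr_const card_ord mulr_natl.
rewrite mxE.
apply: (le_trans (ler_norm_sum _ _ _)); apply: ler_sum => l _.
by rewrite normrM; apply: ler_pM => //; exact: mx_entry_le.
Qed.

(* Unlike the sup norm, this multiple of it is submultiplicative. *)
Definition nrm m n (A : 'M[R]_(m, n)) : R := n.+1%:R * `|A|.

Lemma nrm_ge0 m n (A : 'M[R]_(m, n)) : 0 <= nrm A.
Proof. exact: mulr_ge0. Qed.

Lemma norm_le_nrm m n (A : 'M[R]_(m, n)) : `|A| <= nrm A.
Proof. by rewrite ler_peMl // ler1n. Qed.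

Lemma nrmM m n (A : 'M[R]_(m, n)) (B : 'M[R]_n) : nrm (A *m B) <= nrm A * nrm B.
Proof.
rewrite /nrm (mulrACA) -mulrA ler_wpM2l //.
apply: le_trans (mx_norm_mul A B) _; rewrite ler_wpM2r ?mulr_ge0 //.
by rewrite ler_nat.
Qed.
End MatrixNorm.

Lemma measure_partition d (T : measurableType d) (R : realType) (mu : {measure set T -> \bar R})
    (S : finType) (V : T -> S) (E : set T) :
  (forall s, measurable (E `&` [set t | V t = s])) ->
  mu E = (\sum_s mu (E `&` [set t | V t = s]))%E.
Proof.
move=> mE.
have {1}-> : E = \bigcup_(s in [set` index_enum S]) (E `&` [set t | V t = s]).
  apply/seteqP; split => [t Et|t [s _ []//]].
  by exists (V t) => //=; rewrite mem_index_enum.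
rewrite measure_fin_bigcup //.
- by rewrite -fsbig_seq // index_enum_uniq.
- by move=> s s' _ _ [t [[_ <-] [_ <-]]].
Qed.

(** [A] can be any predicate: a finite alphabet leaves finitely many words of the length of [ks]. *)
Lemma path_event_measurable d (T : measurableType d) r (V : nat -> T -> 'I_r)
    (ks : seq nat) (A : seq 'I_r -> Prop) : (forall n i, measurable [set t | V n t = i]) ->
  measurable [set t | A [seq V k t | k <- ks]].
Proof.
move=> mV; elim: ks A => [|k ks IH] A /=.
  have [a|na] := pselect (A [::]).
    by rewrite (_ : mkset _ = setT) //; apply/seteqP; split.
  by rewrite (_ : mkset _ = set0) //; apply/seteqP; split.
rewrite (_ : mkset _ = \bigcup_(j in [set: 'I_r]) ([set t | V k t = j] `&`
    [set t | A (j :: [seq V k t | k <- ks])])).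
  apply: fin_bigcup_measurable => // j _; apply: measurableI => //.
  exact: (IH (fun s => A (j :: s))).
by apply/seteqP; split => [t /= At|t [j _ [/= -> //]]]; exists (V k t).
Qed.

Section PathExpectation.
Context {R : realType} {r : nat}.
Variable Q : 'M[R]_r.
Hypothesis sQ : stochastic Q.

(* Expectation of F(I_1, ..., I_n) for the chain started at I_0 = i. *)
Fixpoint Epath (n : nat) (i : 'I_r) (F : seq 'I_r -> R) : R :=
  if n is n'.+1 then \sum_j Q i j * Epath n' j (fun s => F (j :: s)) else F [::].

Lemma Epath_le n i F G : (forall s, size s = n -> F s <= G s) ->
  Epath n i F <= Epath n i G.
Proof.
elim: n i F G => [|n IH] i F G FG /=; first exact: FG.
apply: ler_sum => j _; apply: ler_wpM2l; first exact: sQ.1.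
by apply: IH => s sn; apply: FG; rewrite /= sn.
Qed.

Lemma Epath_lin n i a b F G :
  Epath n i (fun s => a * F s + b * G s) = a * Epath n i F + b * Epath n i G.
Proof.
elim: n i F G => [//|n IH] i F G /=.
rewrite !mulr_sumr -big_split /=; apply: eq_bigr => j _.
by rewrite IH; ring.
Qed.

Lemma Epath_cst n i c : Epath n i (fun=> c) = c.
Proof.
elim: n i => //= n IH i; under eq_bigr do rewrite IH.
by rewrite -mulr_suml sQ.2 mul1r.
Qed.

Lemma Epath_scale n i a F : Epath n i (fun s => a * F s) = a * Epath n i F.
Proof.
have := Epath_lin n i a 0 F F; rewrite mul0r addr0 => <-.
by congr (Epath n i _); apply/funext => s; rewrite mul0r addr0.
Qed.

Lemma Epath_ge0 n i F : (forall s, size s = n -> 0 <= F s) -> 0 <= Epath n i F.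
Proof. by move=> F0; rewrite -(Epath_cst n i 0); exact: Epath_le. Qed.

Lemma EpathD m n i F :
  Epath (m + n) i F = Epath m i (fun s => Epath n (last i s) (fun s' => F (s ++ s'))).
Proof. by elim: m i F => [//|m IH] i F /=; apply: eq_bigr => j _; rewrite IH. Qed.

Section Law.
Context d (T : measurableType d) (P : probability T R).
Variables (mu : 'I_r -> R) (V : nat -> T -> 'I_r) (n : nat).
Hypothesis mV : forall n i, measurable [set t | V n t = i].
Hypothesis lawV : forall s : nat -> 'I_r,
  P [set t | forall k, (k <= n)%N -> V k t = s k] =
  (mu (s 0%N) * \prod_(k < n) Q (s k) (s k.+1))%:E.

Let pw i w := \prod_(k < size w) Q (nth i (i :: w) k) (nth i w k).

Lemma path_event_prefix m w i (A : seq 'I_r -> bool) : (size w + m = n)%N ->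
  P ([set t | V 0%N t = i] `&` [set t | [seq V k t | k <- iota 1 (size w)] = w] `&`
     [set t | A [seq V k t | k <- iota 1 n]]) =
  (mu i * (pw i w * Epath m (last i w) (fun s => (A (w ++ s))%:R)))%:E.
Proof.
elim: m w => [|m IH] w; rewrite ?addn0 => wn.
  rewrite /= wn cats0; case: (boolP (A w)) => Aw; last first.
    rewrite !mulr0 (_ : _ `&` _ = set0) ?measure0 //; apply/seteqP; split => //.
    by move=> t [[_ /= ->]]; rewrite (negbTE Aw).
  rewrite mulr1 -[X in (X * _)%:E]/(mu (nth i (i :: w) 0)) /pw wn.
  rewrite -(lawV (nth i (i :: w))); congr (P _); apply/seteqP; split => t /=.
    move=> [[V0 Vw] _] [|k] kn //=; rewrite -Vw (nth_map 0%N) ?size_iota //.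
    by rewrite nth_iota // add1n.
  move=> H; have Vw : [seq V k t | k <- iota 1 n] = w.
    apply: (@eq_from_nth _ i); first by rewrite size_map size_iota.
    move=> k; rewrite size_map size_iota => kn.
    by rewrite (nth_map 0%N) ?size_iota // nth_iota // add1n H.
  by rewrite Vw; split => //; split => //; exact: (H 0%N).
rewrite (measure_partition _ (V := V (size w).+1)) => [|j]; last first.
  rewrite /=; apply: measurableI => //; apply: measurableI; last exact: (path_event_measurable _ (fun l => A l)).
  by apply: measurableI => //; exact: (path_event_measurable _ (fun l => l = w)).
rewrite /= !mulr_sumr -sumEFin; apply: eq_bigr => j _.
have -> : mu i * (pw i w * (Q (last i w) j * Epath m j (fun s => (A (w ++ j :: s))%:R)))
   = mu i * (pw i (rcons w j) * Epath m (last i (rcons w j)) (fun s => (A (rcons w j ++ s))%:R)).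
  rewrite last_rcons /pw size_rcons big_ord_recr /= nth_rcons ltnn eqxx -rcons_cons nth_rcons /= ltnS leqnn.
  rewrite -/(nth i (i :: w) _) -(last_nth i i w) -!mulrA; congr (_ * (_ * (_ * _))).
    apply: eq_bigr => k _; rewrite nth_rcons ltn_ord -rcons_cons nth_rcons /= ltnS.
    by rewrite (ltnW (ltn_ord k)).
  by congr (Epath m j _); apply/funext => s; rewrite cat_rcons.
rewrite -IH ?size_rcons ?addSnnS //; congr (P _).
have -> : iota 1 (size w).+1 = rcons (iota 1 (size w)) (size w).+1.
  by rewrite -[X in iota 1 X]addn1 iotaD add1n cats1.
apply/seteqP; split => t /=.
  by move=> [[[V0 Vw] At] Vj]; rewrite map_rcons Vw Vj.
move=> [[V0]]; rewrite map_rcons => /rcons_inj[Vw Vj] At.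
by split => //; split => //; split.
Qed.

(** The path law is assumed at a single horizon n, so that the formula applies to reversed paths
    [J (n - k)], which change with n. *)
Lemma path_eventE (A : seq 'I_r -> bool) :
  P [set t | A [seq V k t | k <- iota 1 n]] =
  (\sum_i mu i * Epath n i (fun s => (A s)%:R))%:E.
Proof.
rewrite (measure_partition _ (V := V 0%N)) => [|j]; last first.
  by apply: measurableI => //; exact: (path_event_measurable _ (fun l => A l)).
rewrite -sumEFin; apply: eq_bigr => i _.
have := @path_event_prefix n [::] i A (add0n n).
rewrite /pw big_ord0 mul1r /= => <-; congr (P _).
by apply/seteqP; split => t /=; tauto.
Qed.
End Law.
End PathExpectation.

Section Tail.
Context {R : realType} {r p : nat}.
Variables (Q : 'M[R]_r) (alpha : 'I_r -> 'M[R]_p).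
Hypothesis sQ : stochastic Q.

Fixpoint lprod (s : seq 'I_r) : 'M[R]_p :=
  if s is j :: s' then lprod s' *m alpha j else 1%:M.

Lemma lprod_cat s s' : lprod (s ++ s') = lprod s' *m lprod s.
Proof. by elim: s => [|j s IH] /=; rewrite ?mulmx1 // IH mulmxA. Qed.

Lemma mprodE J n : mprod alpha J n = lprod [seq J k | k <- iota 1 n].
Proof.
elim: n => [//|n IH].
rewrite (_ : iota 1 n.+1 = iota 1 n ++ [:: n.+1]); last first.
  by rewrite -[X in iota 1 X = _]addn1 iotaD add1n.
by rewrite map_cat lprod_cat /= mul1mx IH.
Qed.

Lemma powR_root_le (m : nat) (x y : R) : (0 < m)%N -> 0 <= y -> 0 <= x ->
  y <= x ^+ m -> y `^ (m%:R^-1) <= x.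
Proof.
move=> m0 y0 x0 yx; have m0' : m%:R != 0 :> R by rewrite pnatr_eq0 -lt0n.
rewrite -[leRHS](powRr1 x0) -[in leRHS](mulfV m0') powRrM powR_mulrn //.
by apply: ge0_ler_powR; rewrite ?nnegrE ?invr_ge0 ?exprn_ge0.
Qed.

Lemma le_powR_root (m : nat) (x y : R) : (0 < m)%N -> 0 <= x ->
  x ^+ m <= y -> x <= y `^ (m%:R^-1).
Proof.
move=> m0 x0 xy; have m0' : m%:R != 0 :> R by rewrite pnatr_eq0 -lt0n.
rewrite -[leLHS](powRr1 x0) -[in leLHS](mulfV m0') powRrM powR_mulrn //.
apply: ge0_ler_powR; rewrite ?nnegrE ?invr_ge0 ?exprn_ge0 //.
by rewrite (le_trans _ xy) // exprn_ge0.
Qed.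

(** The ratio is b = a^(1/m), and the factor a^-1 pays for rounding n / m down. *)
Lemma expr_div_le (a : R) m : 0 < a < 1 -> (0 < m)%N ->
  exists2 b, 0 < b < 1 & forall n, a ^+ (n %/ m)%N <= a^-1 * b ^+ n.
Proof.
move=> /andP[a0 a1] m0; have m0' : m%:R != 0 :> R by rewrite pnatr_eq0 -lt0n.
pose b := a `^ (m%:R^-1).
have b0 : 0 < b by rewrite powR_gt0.
have bm : b ^+ m = a by rewrite -powR_mulrn ?ltW // -powRrM mulVf // powRr1 // ltW.
have b1 : b < 1.
  rewrite ltNge; apply/negP => h; move: a1; rewrite -bm ltNge => /negP; apply.
  exact: exprn_ege1.
exists b => [|n]; first by rewrite b0.
rewrite ler_pdivlMl // -{1 2}bm -exprM -exprD ler_wiXn2l ?ltW //.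
by rewrite mulnC {1}(divn_eq n m) addnC leq_add2r ltnW // ltn_mod.
Qed.

(* The fractional moment E |A_m ... A_1|^(1/m) is less than 1 for large m: the bad
   event has small probability and |A_m ... A_1|^(1/m) is bounded uniformly in m.
   Submultiplicativity then gives exponential decay along multiples of m. *)
Lemma Epath_tail (c : R) : 0 < c ->
  (forall e : R, 0 < e -> exists N, forall n i, (N <= n)%N ->
     Epath Q n i (fun s => (expR (- c) ^+ n < `|lprod s|)%R%:R) <= e) ->
  exists tau rho C : R, [/\ 0 < tau < 1, 0 < rho < 1, 0 <= C &
    forall n i, Epath Q n i (fun s => (tau ^+ n < `|lprod s|)%R%:R) <= C * rho ^+ n].
Proof.
move=> c0 Hbad; pose q : R := p.+1%:R.
have q1 : 1 <= q by rewrite /q ler1n.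
have q0 : 0 <= q by apply: le_trans q1.
pose K := \big[Num.max/1]_i nrm (alpha i).
have K1 : 1 <= K by apply: bigmax_ge_id.
have K0 : 0 <= K by apply: le_trans K1.
have nK s : nrm (lprod s) <= q * K ^+ size s.
  elim: s => [|j s IH] /=.
    rewrite expr0 mulr1 /nrm ler_piMr // mx_norm_le // => i j.
    by rewrite mxE; case: eqP; rewrite ?normr1 ?normr0.
  apply: (le_trans (nrmM _ _)); rewrite exprSr [in leRHS]mulrA ler_pM ?nrm_ge0 //.
  exact: (le_bigmax 1 (fun i => nrm (alpha i)) j).
(* g carries half of the decay rate; the other half absorbs the constant q of [nrm], since q g^m <=
   1 for large m. Off the bad event this gives phi <= g. *)
pose g := expR (- (c / 2)).
have g0 : 0 < g by exact: expR_gt0.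
have g1 : g < 1 by rewrite /g expR_lt1 oppr_lt0 divr_gt0.
have gg : expR (- c) = g * g by rewrite /g -expRD; congr expR; lra.
(* With this e the bad event, on which phi <= q K, adds at most (1 - g) / 2 to the mean of phi,
   which is then at most (1 + g) / 2 < 1. *)
pose e := (1 - g) / 2 / (q * K).
have qK0 : 0 < q * K by rewrite mulr_gt0 // (lt_le_trans ltr01).
have e0 : 0 < e by rewrite /e !divr_gt0 // subr_gt0.
have [N HN] := Hbad e e0.
have [m [m0 Nm qm]] : exists m, [/\ (0 < m)%N, (N <= m)%N & q * g ^+ m <= 1].
  have : q * g ^+ n @[n --> \oo] --> q * 0.
    by apply: cvgMr; apply: cvg_expr; rewrite ger0_norm // ltW.
  rewrite mulr0 => /cvgrPdist_le/(_ 1 ltr01)[M _ HM].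
  exists (maxn M N).+1; split => //; first by rewrite leqW // leq_maxr.
  have := HM (maxn M N).+1; rewrite /= leqW ?leq_maxl // => /(_ isT).
  by rewrite sub0r normrN ger0_norm // mulr_ge0 // exprn_ge0 // ltW.
pose phi s := nrm (lprod s) `^ (m%:R^-1).
have phi_ge0 s : 0 <= phi s by exact: powR_ge0.
have phiM s s' : phi (s ++ s') <= phi s * phi s'.
  rewrite /phi -powRM ?nrm_ge0 // ge0_ler_powR ?nnegrE ?invr_ge0 ?nrm_ge0 //.
    by rewrite mulr_ge0 ?nrm_ge0.
  by rewrite lprod_cat mulrC nrmM.
have phiL s : (size s <= m)%N -> phi s <= q * K.
  move=> sm; apply: powR_root_le => //; [exact: nrm_ge0|exact: ltW|].
  apply: (le_trans (nK s)); rewrite exprMn ler_pM ?exprn_ge0 //.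
    by rewrite -[leLHS]expr1 ler_weXn2l.
  by rewrite ler_weXn2l.
pose a := (1 + g) / 2.
have a01 : 0 < a < 1.
  by rewrite /a divr_gt0 ?addr_gt0 //= ltr_pdivrMr // mul1r; lra.
have [a0 a1] := andP a01.
have Em i : Epath Q m i phi <= a.
  apply: (@le_trans _ _ (Epath Q m i (fun s => g * 1 +
      (q * K) * (expR (- c) ^+ m < `|lprod s|)%R%:R))).
    apply: Epath_le => // s sm; case: ltP => h /=.
      by rewrite !mulr1; apply: ler_wpDl; rewrite ?(ltW g0) // phiL // sm.
    rewrite mulr0 addr0 mulr1; apply: powR_root_le => //; [exact: nrm_ge0|exact: ltW|].
    rewrite /nrm -/q; apply: (le_trans (ler_wpM2l q0 h)).
    rewrite gg exprMn mulrA -[leRHS]mul1r ler_wpM2r //.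
    by rewrite exprn_ge0 // ltW.
  rewrite (Epath_lin Q m i g (q * K) (fun=> 1)) Epath_cst // mulr1.
  have := HN m i Nm; rewrite -(ler_pM2l qK0) => h.
  apply: (le_trans (lerD (lexx g) h)).
  rewrite /e [q * K * _]mulrC divfK ?gt_eqF // /a; lra.
(* By the Markov property each full block of m letters contributes a factor a, and the incomplete
   block costs q K. *)
have En n i : Epath Q n i phi <= q * K * a ^+ (n %/ m)%N.
  rewrite {1}(divn_eq n m); elim: (n %/ m)%N i => [|k IH] i.
    rewrite mul0n add0n expr0 mulr1 -(Epath_cst sQ (n %% m)%N i (q * K)).
    by apply: Epath_le => // s sn; rewrite phiL // sn ltnW // ltn_mod.
  rewrite mulSn -addnA EpathD.
  apply: (@le_trans _ _ (Epath Q m i (fun s => (q * K * a ^+ k) * phi s))).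
    apply: Epath_le => // s sm.
    apply: (@le_trans _ _ (phi s * Epath Q (k * m + n %% m)%N (last i s) phi)).
      by rewrite -Epath_scale; apply: Epath_le.
    by rewrite mulrC ler_wpM2r.
  by rewrite Epath_scale exprSr mulrA ler_wpM2l // mulr_ge0 ?exprn_ge0 // ltW.
have [b /andP[b0 b1] Hb] := expr_div_le a01 m0.
(* Markov's inequality for phi at level t^n: the mean is of order b^n = t^(2n), so t^n is left after
   division. As phi is an m-th root, the level for the norm is tau^n with tau = t^m. *)
pose t := Num.sqrt b.
have t0 : 0 < t by rewrite sqrtr_gt0.
have tt : t ^+ 2 = b by rewrite sqr_sqrtr // ltW.
have t1 : t < 1 by rewrite -sqrtr1 ltr_sqrt.
exists (t ^+ m), t, (q * K / a); split.
- by rewrite exprn_gt0 // exprn_ilt1 ?ltW // -lt0n m0.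
- by rewrite t0 t1.
- by rewrite divr_ge0 // ltW.
move=> n i.
apply: (@le_trans _ _ (Epath Q n i (fun s => t ^- n * phi s))).
  apply: Epath_le => // s _; case: ltP => h /=; last first.
    by rewrite mulr_ge0 // invr_ge0 exprn_ge0 // ltW.
  rewrite ler_pdivlMl ?exprn_gt0 // mulr1; apply: le_powR_root => //.
    by rewrite exprn_ge0 // ltW.
  rewrite -exprM mulnC exprM; apply: (le_trans (ltW h)); exact: norm_le_nrm.
rewrite Epath_scale ler_pdivrMl ?exprn_gt0 //.
apply: (le_trans (En n i)); rewrite mulrCA -exprD addnn -mul2n exprM tt -[leRHS]mulrA.
by rewrite ler_wpM2l // ltW.
Qed.

(** Almost sure convergence makes the upper limit of the bad events null, so the probability of a
    bad event tends to 0 in stationarity. That probability is the pi-average over the starts;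
    dividing by the least pi i bounds each start. *)
Lemma Epath_lyapunov d (T : measurableType d) (P : probability T R)
    (pi : 'I_r -> R) (I : nat -> T -> 'I_r) (lambda : \bar R) :
  prob_vector pi -> (forall i, 0 < pi i) -> (lambda < 0)%E -> markov_chain P pi Q I ->
  {ae P, forall t,
     (((n.+1%:R)^-1)%:E * elog `|mprod alpha (I ^~ t) n.+1|)%E @[n --> \oo] --> lambda} ->
  exists2 c : R, 0 < c & (forall e : R, 0 < e -> exists N, forall n i, (N <= n)%N ->
     Epath Q n i (fun s => (expR (- c) ^+ n < `|lprod s|)%R%:R) <= e).
Proof.
move=> [pi0 pi1] pig l0 [mI lawI] lyap.
(* -c lies strictly between lambda and 0; when lambda is -oo any rate serves. *)
have [c c0 lc] : exists2 c : R, 0 < c & (lambda < (- c)%:E)%E.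
  case: lambda l0 {lyap} => [l||] //; last by exists 1; rewrite ?ltNyr.
  by rewrite lte_fin => l0; exists (- l / 2); rewrite ?lte_fin; lra.
exists c => // e e0.
pose bad n := [set t | expR (- c) ^+ n < `|lprod [seq I k t | k <- iota 1 n]|].
have mbad n : measurable (bad n).
  exact: (@path_event_measurable _ _ _ I _ (fun s => expR (- c) ^+ n < `|lprod s|)).
have bad0 : P (lim_sup_set bad) = 0%E.
  apply/negligibleP; first by apply: bigcap_measurable => // n _; exact: bigcup_measurable.
  apply: negligibleS lyap => t /= Hbad lim.
  have [N _ HN] : \forall n \near \oo, (((n.+1%:R)^-1)%:E *
     elog `|mprod alpha (fun k => I k t) n.+1| < (- c)%:E)%E.
    apply: (lim [set x | (x < (- c)%:E)%E]); apply: open_nbhs_nbhs; split => //; exact: open_ereal_lt_ereal.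
  have [[//|n] Nn] := Hbad N.+1 Logic.I.
  apply/negP; rewrite -leNgt -mprodE.
  have := HN n Nn; rewrite /elog; case: eqP => [->|/eqP x0].
    by move=> _; rewrite exprn_ge0 // expR_ge0.
  have x1 : 0 < `|mprod alpha (fun k => I k t) n.+1| by rewrite lt_def x0 /=.
  rewrite -EFinM lte_fin ltr_pdivrMl // => h.
  rewrite -[leLHS]lnK ?posrE // -expRM_natl ler_expR ltW //.
have badcvg : P (\bigcup_(k >= n) bad k) @[n --> \oo] --> 0%E.
  rewrite -bad0; apply: lim_sup_set_cvg => //; apply: le_lt_trans (ltry 1).
  by apply: probability_le1; exact: bigcup_measurable.
pose pm := \big[Num.min/1]_i pi i.
have pm0 : 0 < pm by exact: lt_bigmin.
have [N _ HN] : \forall n \near \oo, (P (\bigcup_(k >= n) bad k) < (pm * e)%:E)%E.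
  apply: (badcvg [set x | (x < (pm * e)%:E)%E]); apply: open_nbhs_nbhs; split.
    exact: open_ereal_lt_ereal.
  by rewrite /= lte_fin mulr_gt0.
exists N => n i Nn.
have : (P (bad n) <= (pm * e)%:E)%E.
  apply: le_trans (ltW (HN n Nn)); apply: le_measure; rewrite ?inE //.
    exact: bigcup_measurable.
  by move=> t bt; exists n => /=.
rewrite [P _](path_eventE mI (lawI n) (fun s => expR (- c) ^+ n < `|lprod s|)) lee_fin => H.
rewrite -(ler_pM2l pm0); apply: le_trans H.
rewrite (bigD1 i) //= -[leLHS]addr0 lerD //.
  apply: ler_wpM2r; first exact: Epath_ge0.
  by rewrite /pm; apply: (bigmin_inf i).
by apply: sumr_ge0 => j _; apply: mulr_ge0 => //; exact: Epath_ge0.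
Qed.
End Tail.

(** * Random matrices and laws of noise *)

Section RandomMatrices.
Context {R : realType} {d} {T : measurableType d}.

Lemma measurable_gt (g : T -> R) c :
  measurable_fun setT g -> measurable [set t | c < g t].
Proof.
move=> mg; rewrite -[X in measurable X]setTI.
rewrite (_ : mkset _ = g @^-1` `]c, +oo[); first exact: mg.
by apply/seteqP; split => t /=; rewrite in_itv /= andbT.
Qed.

Lemma measurable_fin_comp r (J : T -> 'I_r) (c : 'I_r -> R) :
  (forall i, measurable [set t | J t = i]) -> measurable_fun setT (fun t => c (J t)).
Proof.
move=> mJ; rewrite (_ : (fun _ => _) = (fun t => \sum_i \1_[set t | J t = i] t * c i)).
  by apply: measurable_sum => i; exact: measurable_funM.
apply/funext => t; rewrite (bigD1 (J t)) //= indicE mem_set // mul1r big1 ?addr0 //.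
by move=> i iJ; rewrite indicE memNset ?mul0r //= => /esym/eqP; rewrite (negbTE iJ).
Qed.

(** U is the union of the countably many boxes inside it that have a rational centre and a radius 1
    / (k + 1), and a box is a finite set of conditions on entries. *)
Lemma random_mx_preimage_open m n (X : T -> 'M[R]_(m, n)) (U : set 'M[R]_(m, n)) :
  random_mx X -> open U -> measurable (X @^-1` U).
Proof.
move=> mX oU.
pose box (qk : 'M[rat]_(m, n) * nat) : set 'M[R]_(m, n) :=
  [set A | forall i j, `|A i j - ratr (qk.1 i j)| < qk.2.+1%:R^-1].
have -> : X @^-1` U = \bigcup_qk (X @^-1` box qk `&` [set t | box qk `<=` U]).
  apply/seteqP; split => [t /= Ut|t [qk _ [/= bX]]]; last exact.
  have [e /= e0 eU] : nbhs_ball (X t) U by apply/nbhs_ballP; exact: open_nbhs_nbhs.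
  (* Half of e, because the box is centred at a rational point near [X t] and not at [X t]
     itself. *)
  have [k ke] : exists k : nat, k.+1%:R^-1 < e / 2.
    have := near_infty_natSinv_lt (PosNum (divr_gt0 e0 (ltr0Sn R 1))).
    by move=> [k _ Hk]; exists k; apply: Hk => /=.
  have exq ij : exists q : rat, `|X t ij.1 ij.2 - ratr q| < k.+1%:R^-1.
    have lt : X t ij.1 ij.2 - k.+1%:R^-1 < X t ij.1 ij.2 + k.+1%:R^-1.
      by rewrite ltrBlDr -addrA ltrDl addr_gt0 // invr_gt0.
    have [q] := rat_in_itvoo lt.
    by rewrite in_itv /= => /andP[h1 h2]; exists q; rewrite ltr_distlC h1 h2.
  have [q Hq] := choice exq.
  exists (\matrix_(i, j) q (i, j), k) => //; split.
    by move=> i j; rewrite /= mxE; exact: (Hq (i, j)).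
  move=> A /= HA; apply: eU; split => //= i j; rewrite /ball /=.
  have := HA i j; have := Hq (i, j); rewrite mxE /= => h1 h2.
  apply: (@lt_trans _ _ (k.+1%:R^-1 + k.+1%:R^-1)); last by rewrite [ltRHS]splitr ltrD.
  rewrite -(subrK (ratr (q (i, j))) (X t i j)) -addrA.
  by apply: (le_lt_trans (ler_normD _ _)); apply: ltrD => //; rewrite distrC.
apply: countable_bigcupT_measurable; first exact: countableP.
move=> qk; have [sub|nsub] := pselect (box qk `<=` U); last first.
  by rewrite (_ : _ `&` _ = set0) //; apply/seteqP; split => // t [].
rewrite (_ : _ `&` _ = X @^-1` box qk); last first.
  by apply/seteqP; split => [t []//|t]; split.
rewrite (_ : _ @^-1` _ = \bigcap_(ij in [set: 'I_m * 'I_n])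
   [set t | `|X t ij.1 ij.2 - ratr (qk.1 ij.1 ij.2)| < qk.2.+1%:R^-1]); last first.
  by apply/seteqP; split => [t H ij _|t H i j]; [exact: H|exact: (H (i, j))].
apply: fin_bigcap_measurable => //= -[i j] _ /=.
rewrite -[X in measurable X]setTI.
have mf : measurable_fun setT (fun t => `|X t i j - ratr (qk.1 i j)|).
  by apply: measurableT_comp => //; apply: measurable_funB.
rewrite (_ : mkset _ = (fun t => `|X t i j - ratr (qk.1 i j)|) @^-1` `]-oo, qk.2.+1%:R^-1[).
  exact: mf.
by apply/seteqP; split => t /=; rewrite in_itv.
Qed.

Lemma measurable_cont_random_mx m n (X : T -> 'M[R]_(m, n)) (f : 'M[R]_(m, n) -> R) :
  random_mx X -> continuous f -> measurable_fun setT (fun t => f (X t)).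
Proof.
move=> mX cf; apply: (measurability _ (RGenOInfty.measurableE R)).
move=> _ [_ [x ->] <-]; rewrite setTI.
rewrite (_ : _ @^-1` _ = X @^-1` (f @^-1` `]x, +oo[)) //.
apply: random_mx_preimage_open => //; apply: open_comp; last exact: interval_open.
by move=> A _; exact: cf.
Qed.

Lemma measurable_norm_gt m n (X : T -> 'M[R]_(m, n)) c :
  random_mx X -> measurable [set t | c < `|X t|].
Proof.
move=> mX; apply: measurable_gt.
apply: (measurable_cont_random_mx (f := fun A : 'M[R]_(m, n) => `|A|) mX) => //.
by move=> A; exact: norm_continuous.
Qed.

Lemma borel_random_mx m n (X : T -> 'M[R]_(m, n)) :
  (forall B, borel_mx B -> measurable (X @^-1` B)) -> random_mx X.
Proof.
move=> mX i j; apply: (measurability _ (RGenOInfty.measurableE R)).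
move=> _ [_ [x ->] <-]; rewrite setTI.
rewrite (_ : _ @^-1` _ = X @^-1` ((fun A => A i j) @^-1` `]x, +oo[)) //.
apply: mX; apply: sub_sigma_algebra; apply: open_comp; last exact: interval_open.
by move=> A _; exact: coord_continuous.
Qed.

Lemma random_mxD m n (X Y : T -> 'M[R]_(m, n)) :
  random_mx X -> random_mx Y -> random_mx (fun t => X t + Y t).
Proof.
move=> mX mY i j; rewrite (_ : (fun _ => _) = (fun t => X t i j + Y t i j)).
  exact: measurable_funD.
by apply/funext => t; rewrite mxE.
Qed.

Lemma random_mxM m n k (X : T -> 'M[R]_(m, n)) (Y : T -> 'M[R]_(n, k)) :
  random_mx X -> random_mx Y -> random_mx (fun t => X t *m Y t).
Proof.
move=> mX mY i j.
rewrite (_ : (fun _ => _) = (fun t => \sum_l X t i l * Y t l j)).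
  by apply: measurable_sum => l; exact: measurable_funM.
by apply/funext => t; rewrite mxE.
Qed.

Lemma random_mx_cst m n (A : 'M[R]_(m, n)) : random_mx (fun _ : T => A).
Proof. by move=> i j; exact: measurable_cst. Qed.

Lemma random_mx_select r m n (J : T -> 'I_r) (X : T -> 'I_r -> 'M[R]_(m, n)) :
  (forall i, measurable [set t | J t = i]) -> (forall i, random_mx (X ^~ i)) ->
  random_mx (fun t => X t (J t)).
Proof.
move=> mJ mX i j.
rewrite (_ : (fun _ => _) = (fun t => \sum_l \1_[set t | J t = l] t * X t l i j)).
  by apply: measurable_sum => l; apply: measurable_funM => //; exact: mX.
apply/funext => t; rewrite (bigD1 (J t)) //= indicE mem_set // mul1r big1 ?addr0 // => l lJ.
by rewrite indicE memNset ?mul0r //= => /esym/eqP; rewrite (negbTE lJ).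
Qed.

Lemma random_mx_col r p (J : T -> 'I_r) (X : T -> 'M[R]_(p, r)) :
  (forall i, measurable [set t | J t = i]) -> random_mx X ->
  random_mx (fun t => col (J t) (X t)).
Proof.
move=> mJ mX; apply: (random_mx_select (X := fun t i => col i (X t))) => // i k j.
by under eq_fun do rewrite mxE; exact: mX.
Qed.

Lemma random_mx_Xseq r p (alpha : 'I_r -> 'M[R]_p) (J : nat -> T -> 'I_r)
    (eps : nat -> T -> 'M[R]_(p, r)) (X0 : T -> 'cV[R]_p) n :
  (forall k i, measurable [set t | J k t = i]) ->
  (forall k, (1 <= k <= n)%N -> random_mx (eps k)) -> random_mx X0 ->
  random_mx (fun t => Xseq alpha (J ^~ t) (eps ^~ t) (X0 t) n).
Proof.
move=> mJ meps mX0; elim: n meps => [//|n IH] meps /=.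
apply: random_mxD; last by apply: random_mx_col => //; apply: meps; rewrite ltnSn.
apply: random_mxM.
  by apply: (random_mx_select (X := fun=> alpha)) => // i; exact: random_mx_cst.
by apply: IH => k /andP[k0 kn]; apply: meps; rewrite k0 leqW.
Qed.

End RandomMatrices.

Lemma ge0_integral_mrestr d (T : measurableType d) (R : realType)
    (mu : {measure set T -> \bar R}) (D : set T) (mD : measurable D) (f : T -> \bar R) :
  measurable_fun setT f -> (forall t, 0 <= f t)%E ->
  (\int[mrestr mu mD]_t f t = \int[mu]_(t in D) f t)%E.
Proof.
move=> mf f0.
rewrite (@ge0_negligible_integral _ _ _ _ setT (~` D)) //; last 2 first.
- exact: measurableC.
- by rewrite /= /mrestr setICl measure0.
rewrite setTD setCK; apply: eq_measure_integral => A mA AD.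
by rewrite /= /mrestr setIidl.
Qed.

Section Transfer.
Context {R : realType} {r p : nat}.

Lemma noise_event_measurable d (T : measurableType d) (e : nat -> T -> 'M[R]_(p, r))
    (B : nat -> set 'M[R]_(p, r)) n :
  (forall k B, borel_mx B -> measurable (e k @^-1` B)) -> (forall k, borel_mx (B k)) ->
  measurable [set t | forall k, (1 <= k <= n)%N -> B k (e k t)].
Proof.
move=> me mB.
rewrite (_ : mkset _ = \bigcap_(k in [set k | (1 <= k <= n)%N]) (e k @^-1` B k)) //.
apply: fin_bigcap_measurable => [|k _]; last exact: me.
by apply: (sub_finite_set (B := `I_n.+1)) => // k /= /andP[_]; rewrite ltnS.
Qed.

(** A pi-system whose generated sigma-algebra on noise sequences sees just the coordinates that
    enter X_n; index 0 is excluded because the recursion starts with the noise of time 1. *)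
Definition noise_rect n : set (set (nat -> 'M[R]_(p, r))) :=
  [set C | exists2 B : nat -> set 'M[R]_(p, r), forall k, borel_mx (B k) &
     C = [set w | forall k, (1 <= k <= n)%N -> B k (w k)]].

Lemma borel_mxT m n : @borel_mx R m n setT.
Proof. by apply: sub_sigma_algebra; exact: openT. Qed.

Lemma borel_mxI m n (A B : set 'M[R]_(m, n)) : borel_mx A -> borel_mx B -> borel_mx (A `&` B).
Proof. exact: (@measurableI _ (g_sigma_algebraType [set U : set 'M[R]_(m, n) | open U])). Qed.

Lemma random_mx_coord n k : (1 <= k <= n)%N ->
  random_mx (fun w : g_sigma_algebraType (noise_rect n) => w k).
Proof.
move=> kn; apply: borel_random_mx => B mB; apply: sub_sigma_algebra.
exists (fun l => if l == k then B else setT).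
  by move=> l; case: ifP => // _; exact: borel_mxT.
apply/seteqP; split => w /=.
  by move=> Bw l _; case: eqP => // ->.
by move=> /(_ k kn); rewrite eqxx.
Qed.

Context d1 (T1 : measurableType d1) (P1 : probability T1 R).
Context d2 (T2 : measurableType d2) (P2 : probability T2 R).
Variables (e1 : nat -> T1 -> 'M[R]_(p, r)) (e2 : nat -> T2 -> 'M[R]_(p, r)) (n : nat).
Hypothesis me1 : forall k B, borel_mx B -> measurable (e1 k @^-1` B).
Hypothesis me2 : forall k B, borel_mx B -> measurable (e2 k @^-1` B).

Lemma noise_measurable d (T : measurableType d) (e : nat -> T -> 'M[R]_(p, r)) :
  (forall k B, borel_mx B -> measurable (e k @^-1` B)) ->
  measurable_fun setT (fun t => e ^~ t : g_sigma_algebraType (noise_rect n)).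
Proof.
move=> me; apply: (@measurability _ _ T (g_sigma_algebraType (noise_rect n)) _ _ (noise_rect n) erefl).
move=> _ [_ [B mB ->] <-]; rewrite setTI.
exact: noise_event_measurable.
Qed.

(** Both sides are integrals of h against measures on the space of noise sequences, the
    push-forwards of the restrictions to A1 and A2. These agree on the pi-system of rectangles,
    hence everywhere. *)
Lemma noise_transfer (A1 : set T1) (A2 : set T2) (c : {nonneg R})
    (h : g_sigma_algebraType (noise_rect n) -> \bar R) :
  measurable A1 -> measurable A2 ->
  (forall B, (forall k, borel_mx (B k)) ->
     P1 (A1 `&` [set t | forall k, (1 <= k <= n)%N -> B k (e1 k t)]) =
     (c%:num%:E * P2 (A2 `&` [set t | forall k, (1 <= k <= n)%N -> B k (e2 k t)]))%E) ->
  measurable_fun setT h -> (forall w, 0 <= h w)%E ->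
  (\int[P1]_(t in A1) h (e1 ^~ t) = c%:num%:E * \int[P2]_(t in A2) h (e2 ^~ t))%E.
Proof.
move=> mA1 mA2 H mh h0.
have m1 := noise_measurable me1; have m2 := noise_measurable me2.
rewrite -(ge0_integral_mrestr P1 mA1) //; last exact: (measurableT_comp mh m1).
rewrite -(ge0_integral_mrestr P2 mA2) //; last exact: (measurableT_comp mh m2).
have := ge0_integral_pushforward m1 (mrestr P1 mA1) measurableT mh (in1W h0).
rewrite preimage_setT => <-.
have := ge0_integral_pushforward m2 (mrestr P2 mA2) measurableT mh (in1W h0).
rewrite preimage_setT => <-.
rewrite -ge0_integral_mscale //; apply: eq_measure_integral => C mC _.
apply: (@measure_unique _ R (g_sigma_algebraType (noise_rect n)) (noise_rect n) (fun=> setT)) => //.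
- move=> _ _ [B mB ->] [B' mB' ->]; exists (fun k => B k `&` B' k).
    by move=> k; exact: borel_mxI.
  apply/seteqP; split => w /=; first by move=> [b b'] k kn; split; [exact: b|exact: b'].
  by move=> b; split => k kn; have [] := b k kn.
- by move=> _; exists (fun=> setT) => [_|]; [exact: borel_mxT|apply/seteqP; split].
- by apply: bigcup_const; exists 0%N.
- move=> _ [B mB ->]; have := H B mB.
  by rewrite setIC [X in (_ * P2 X)%E]setIC.
- move=> _; rewrite /= /pushforward /mrestr; apply: le_lt_trans (ltry 1).
  apply: probability_le1; apply: measurableI => //; rewrite -[X in measurable X]setTI; exact: m1.
Qed.
End Transfer.

Section BoundedIntegral.
Context {R : realType} d (T : measurableType d) (P : probability T R).

Lemma bounded_integrable (f : T -> R) M : measurable_fun setT f ->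
  (forall t, `|f t| <= M) -> P.-integrable setT (EFin \o f).
Proof.
move=> mf fM; apply: measurable_bounded_integrable => //.
  exact: le_lt_trans (probability_le1 P measurableT) (ltry 1).
by exists M; split; rewrite ?num_real // => x Mx t _; exact: le_trans (ltW Mx).
Qed.

Lemma Rintegral_cstT (c : R) : \int[P]_(t in setT) c = c.
Proof.
rewrite Rintegral_cst // -[RHS]mulr1; congr (_ * _).
exact: (congr1 fine (probability_setT P)).
Qed.

Lemma Rintegral_norm_le (f : T -> R) M : measurable_fun setT f ->
  (forall t, `|f t| <= M) -> `|\int[P]_t f t| <= M.
Proof.
move=> mf fM; apply: le_trans (le_normr_Rintegral _ (bounded_integrable mf fM)) _ => //.
rewrite -[leRHS]Rintegral_cstT.
apply: le_Rintegral => //.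
  apply: (bounded_integrable (M := M)) => [|t]; last by rewrite normr_id.
  exact: measurableT_comp.
by apply: (bounded_integrable (M := `|M|)).
Qed.

Lemma Rintegral_addc (f : T -> R) M c : measurable_fun setT f ->
  (forall t, `|f t| <= M) -> \int[P]_t (f t + c) = \int[P]_t f t + c.
Proof.
move=> mf fM; rewrite RintegralD //.
- by rewrite Rintegral_cstT.
- exact: bounded_integrable fM.
- by apply: (bounded_integrable (M := `|c|)).
Qed.
End BoundedIntegral.

Lemma ge0_integral_partition d (T : measurableType d) (R : realType)
    (mu : {measure set T -> \bar R}) (S : finType) (V : T -> S) (f : T -> \bar R) :
  (forall s, measurable [set t | V t = s]) -> measurable_fun setT f ->
  (forall t, 0 <= f t)%E ->
  (\int[mu]_t f t = \sum_s \int[mu]_(t in [set t | V t = s]) f t)%E.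
Proof.
move=> mV mf f0.
have E : \big[setU/set0]_(s <- index_enum S) [set t | V t = s] = setT.
  rewrite -bigcup_seq; apply/seteqP; split => // t _.
  by exists (V t) => //=; rewrite mem_index_enum.
rewrite -{1}E ge0_integral_bigsetU //; first exact: index_enum_uniq.
- by move=> s s' _ _ [t [<- <-]].
- by rewrite E.
Qed.

(** * Comparing functionals of two chains with noise *)

Section ChainTransfer.
Context {R : realType} {r p : nat}.

Definition path_rect d (T : measurableType d) (V : nat -> T -> 'I_r)
    (e : nat -> T -> 'M[R]_(p, r)) n s B :=
  [set t | forall k, (k <= n)%N -> V k t = s k] `&`
  [set t | forall k, (1 <= k <= n)%N -> B k (e k t)].

Lemma chain_functional_measurable d (T : measurableType d) (V : nat -> T -> 'I_r)
    (e : nat -> T -> 'M[R]_(p, r)) n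
    (G : (nat -> 'I_r) -> g_sigma_algebraType (@noise_rect R r p n) -> R) :
  (forall k i, measurable [set t | V k t = i]) ->
  (forall k B, borel_mx B -> measurable (e k @^-1` B)) ->
  (forall s, measurable_fun setT (G s)) ->
  (forall s s' w, (forall k, (k <= n)%N -> s k = s' k) -> G s w = G s' w) ->
  measurable_fun setT (fun t => G (V ^~ t) (e ^~ t)).
Proof.
move=> mV me mG loc.
pose U t := [ffun k : 'I_n.+1 => V k t].
have mU v : measurable [set t | U t = v].
  rewrite (_ : mkset _ = [set t | forall k, (k <= n)%N -> V k t = v (inord k)]).
    exact: (path_measurable (fun k => v (inord k))).
  apply/seteqP; split => t /=; first by move=> <- k kn; rewrite ffunE inordK.
  by move=> H; apply/ffunP => k; rewrite ffunE H ?inord_val // -ltnS.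
rewrite (_ : (fun _ => _) =
   (fun t => \sum_v \1_[set t | U t = v] t * G (fun k => v (inord k)) (e ^~ t))).
  apply: measurable_sum => v; apply: measurable_funM => //.
  exact: (measurableT_comp (mG (fun k => v (inord k))) (noise_measurable me)).
apply/funext => t; rewrite (bigD1 (U t)) //= indicE mem_set // mul1r big1 ?addr0.
  by apply: loc => k kn; rewrite ffunE inordK.
by move=> v vU; rewrite indicE memNset ?mul0r //= => /esym/eqP; rewrite (negbTE vU).
Qed.

Context d1 (T1 : measurableType d1) (P1 : probability T1 R).
Context d2 (T2 : measurableType d2) (P2 : probability T2 R).
Variables (V1 : nat -> T1 -> 'I_r) (e1 : nat -> T1 -> 'M[R]_(p, r)).
Variables (V2 : nat -> T2 -> 'I_r) (e2 : nat -> T2 -> 'M[R]_(p, r)).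
Variables (n : nat) (c : 'I_r -> {nonneg R}).
Variable G : (nat -> 'I_r) -> g_sigma_algebraType (@noise_rect R r p n) -> R.
Hypothesis mV1 : forall k i, measurable [set t | V1 k t = i].
Hypothesis mV2 : forall k i, measurable [set t | V2 k t = i].
Hypothesis me1 : forall k B, borel_mx B -> measurable (e1 k @^-1` B).
Hypothesis me2 : forall k B, borel_mx B -> measurable (e2 k @^-1` B).
Hypothesis law : forall s B, (forall k, borel_mx (B k)) ->
  P1 (path_rect V1 e1 n s B) = ((c (s 0%N))%:num%:E * P2 (path_rect V2 e2 n s B))%E.
Hypothesis mG : forall s, measurable_fun setT (G s).
Hypothesis local : forall s s' w, (forall k, (k <= n)%N -> s k = s' k) -> G s w = G s' w.

(** On each of the finitely many words of length n + 1, G is a function of the noise alone and the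
    density c is a constant, so the transfer for noise applies word by word. *)
Lemma ge0_chain_transfer : (forall s w, 0 <= G s w) ->
  (\int[P1]_t (G (V1 ^~ t) (e1 ^~ t))%:E =
   \int[P2]_t ((c (V2 0%N t))%:num * G (V2 ^~ t) (e2 ^~ t))%:E)%E.
Proof.
move=> G0.
pose U1 t := [ffun k : 'I_n.+1 => V1 k t].
pose U2 t := [ffun k : 'I_n.+1 => V2 k t].
have E1 v : [set t | U1 t = v] = [set t | forall k, (k <= n)%N -> V1 k t = v (inord k)].
  apply/seteqP; split => t /=; first by move=> <- k kn; rewrite ffunE inordK.
  by move=> H; apply/ffunP => k; rewrite ffunE H ?inord_val // -ltnS.
have E2 v : [set t | U2 t = v] = [set t | forall k, (k <= n)%N -> V2 k t = v (inord k)].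
  apply/seteqP; split => t /=; first by move=> <- k kn; rewrite ffunE inordK.
  by move=> H; apply/ffunP => k; rewrite ffunE H ?inord_val // -ltnS.
have mU1 v : measurable [set t | U1 t = v].
  by rewrite E1; exact: (path_measurable (fun k => v (inord k))).
have mU2 v : measurable [set t | U2 t = v].
  by rewrite E2; exact: (path_measurable (fun k => v (inord k))).
have mc := measurable_fin_comp (fun i => (c i)%:num) (mV2 0).
have mG1 := chain_functional_measurable mV1 me1 mG local.
have mG2 := chain_functional_measurable mV2 me2 mG local.
rewrite (ge0_integral_partition _ mU1); last 2 first.
- exact/measurable_EFinP.
- by move=> t; rewrite lee_fin.
rewrite (ge0_integral_partition _ mU2); last 2 first.
- by apply/measurable_EFinP; exact: measurable_funM.
- by move=> t; rewrite lee_fin mulr_ge0.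
apply: eq_bigr => v _; pose s k := v (inord k).
rewrite (eq_integral (fun t => (G s (e1 ^~ t))%:E)); last first.
  move=> t; rewrite inE /= => Ut; congr (_%:E); apply: local => k kn.
  by rewrite /s -Ut ffunE inordK.
rewrite [RHS](eq_integral (fun t => ((c (s 0%N))%:num%:E * (G s (e2 ^~ t))%:E)%E)); last first.
  move=> t; rewrite inE /= => Ut; rewrite -EFinM; congr (_%:E).
  have H k : (k <= n)%N -> V2 k t = s k by move=> kn; rewrite /s -Ut ffunE inordK.
  by rewrite H //; congr (_ * _); exact: local.
rewrite ge0_integralZl //; last 2 first.
- apply/measurable_funTS/measurable_EFinP.
  exact: (measurableT_comp (mG _) (noise_measurable me2)).
- by move=> t _; rewrite lee_fin.
apply: (noise_transfer me1 me2 (h := fun w => (G s w)%:E)) => //.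
- by move=> B mB; have := law s mB; rewrite /path_rect -/(s) E1 E2.
- exact/measurable_EFinP.
- by move=> w; rewrite lee_fin.
Qed.

End ChainTransfer.

(** The transfer formula wants a nonnegative functional, hence the shift to H = G + M with values in
    [0, 2M]. Both spaces have mass 1, so the shift cancels and the difference is the integral of (c
    - 1) H. *)
Lemma chain_compare (R : realType) (r p : nat)
    d1 (T1 : measurableType d1) (P1 : probability T1 R)
    d2 (T2 : measurableType d2) (P2 : probability T2 R)
    (V1 : nat -> T1 -> 'I_r) (e1 : nat -> T1 -> 'M[R]_(p, r))
    (V2 : nat -> T2 -> 'I_r) (e2 : nat -> T2 -> 'M[R]_(p, r))
    (n : nat) (c : 'I_r -> {nonneg R})
    (G : (nat -> 'I_r) -> g_sigma_algebraType (@noise_rect R r p n) -> R) (M eps : R) :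
  (forall k i, measurable [set t | V1 k t = i]) ->
  (forall k i, measurable [set t | V2 k t = i]) ->
  (forall k B, borel_mx B -> measurable (e1 k @^-1` B)) ->
  (forall k B, borel_mx B -> measurable (e2 k @^-1` B)) ->
  (forall s B, (forall k, borel_mx (B k)) ->
    P1 (path_rect V1 e1 n s B) = ((c (s 0%N))%:num%:E * P2 (path_rect V2 e2 n s B))%E) ->
  (forall s, measurable_fun setT (G s)) ->
  (forall s s' w, (forall k, (k <= n)%N -> s k = s' k) -> G s w = G s' w) ->
  (forall s w, `|G s w| <= M) ->
  (forall i, `|(c i)%:num - 1| <= eps) ->
  `|\int[P1]_t G (V1 ^~ t) (e1 ^~ t) - \int[P2]_t G (V2 ^~ t) (e2 ^~ t)| <= eps * (M *+ 2).
Proof.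
move=> mV1 mV2 me1 me2 law mG loc GM ceps.
pose H s w := G s w + M.
have H0 s w : 0 <= H s w.
  by have := GM s w; rewrite ler_norml /H -lerBlDr sub0r => /andP[].
have HM s w : H s w <= M *+ 2.
  by have := GM s w; rewrite ler_norml /H mulr2n lerD2r => /andP[].
have nH s w : `|H s w| <= M *+ 2 by rewrite ger0_norm.
have mH s : measurable_fun setT (H s) by exact: measurable_funD.
have locH s s' w : (forall k, (k <= n)%N -> s k = s' k) -> H s w = H s' w.
  by move=> ss'; rewrite /H (loc s s').
have mG1 := chain_functional_measurable mV1 me1 mG loc.
have mG2 := chain_functional_measurable mV2 me2 mG loc.
have mH2 := chain_functional_measurable mV2 me2 mH locH.
have := ge0_chain_transfer mV1 mV2 me1 me2 law mH locH H0.
move=> /(congr1 fine); rewrite -!/(Rintegral _ _ _).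
have mc := measurable_fin_comp (fun i => (c i)%:num) (mV2 0).
have i1 : P2.-integrable setT (EFin \o (fun t => H (V2 ^~ t) (e2 ^~ t))).
  exact: bounded_integrable (fun t => nH _ _).
have cle t : `|((c (V2 0%N t))%:num - 1) * H (V2 ^~ t) (e2 ^~ t)| <= eps * (M *+ 2).
  by rewrite normrM ler_pM.
have mc1 : measurable_fun setT (fun t => ((c (V2 0%N t))%:num - 1) * H (V2 ^~ t) (e2 ^~ t)).
  by apply: measurable_funM => //; exact: measurable_funB.
have i2 := bounded_integrable P2 mc1 cle.
have -> : \int[P2]_t ((c (V2 0%N t))%:num * H (V2 ^~ t) (e2 ^~ t)) =
    \int[P2]_t H (V2 ^~ t) (e2 ^~ t) +
    \int[P2]_t (((c (V2 0%N t))%:num - 1) * H (V2 ^~ t) (e2 ^~ t)).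
  rewrite -RintegralD //; apply: eq_Rintegral => t _.
  by rewrite mulrBl mul1r addrC subrK.
rewrite (Rintegral_addc P1 M mG1 (fun t => GM _ _)) (Rintegral_addc P2 M mG2 (fun t => GM _ _)).
move=> e.
rewrite (_ : _ - _ = \int[P2]_t (((c (V2 0%N t))%:num - 1) * H (V2 ^~ t) (e2 ^~ t))).
  exact: Rintegral_norm_le.
by lra.
Qed.

(** * Joint laws and time reversal *)

Section JointLaw.
Context {R : realType} {r p : nat}.
Implicit Types (Q : 'M[R]_r) (mu : 'I_r -> R) (nu : set 'M[R]_(p, r) -> R).

(** The two hypotheses on chain and noise merged into one formula on rectangles, a form that
    survives a shift of time and, at each fixed horizon, its reversal. *)
Definition joint_law d (T : measurableType d) (P : probability T R) mu Q nu
    (I : nat -> T -> 'I_r) (e : nat -> T -> 'M[R]_(p, r)) : Prop :=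
  forall n s B, (forall k, borel_mx (B k)) ->
    P (path_rect I e n s B) =
    (mu (s 0%N) * \prod_(k < n) Q (s k) (s k.+1) * \prod_(1 <= k < n.+1) nu (B k))%:E.

Section OneSpace.
Context d (T : measurableType d) (P : probability T R).
Variables (Q : 'M[R]_r) (nu : set 'M[R]_(p, r) -> R).

Lemma iid_joint_law mu I e : markov_chain P mu Q I -> iid_indep_noise P I e nu ->
  joint_law P mu Q nu I e.
Proof. by move=> [_ HI] [_ He] n s B mB; rewrite /path_rect He // HI -EFinM. Qed.

Lemma noise_rectE mu I e n B : markov_chain P mu Q I -> iid_indep_noise P I e nu ->
  (forall k, borel_mx (B k)) ->
  P [set t | forall k, (1 <= k <= n)%N -> B k (e k t)] = (\prod_(1 <= k < n.+1) nu (B k))%:E.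
Proof.
move=> [mI HI] [me He] mB.
have mrect := noise_event_measurable n me mB.
have E i : [set t | forall k, (k <= 0)%N -> I k t = i] = [set t | I 0%N t = i].
  by apply/seteqP; split => t /=; [apply|move=> ti k; rewrite leqn0 => /eqP ->].
rewrite (measure_partition _ (V := I 0%N)) => [|i]; last exact: measurableI.
have -> : (\prod_(1 <= k < n.+1) nu (B k))%:E =
   (\sum_i P (setT `&` [set t | I 0%N t = i]) * (\prod_(1 <= k < n.+1) nu (B k))%:E)%E.
  rewrite -ge0_sume_distrl; last by move=> i _; exact: measure_ge0.
  rewrite -measure_partition => [|i]; last exact: measurableI.
  by rewrite [X in (X * _)%E](probability_setT P) mul1e.
apply: eq_bigr => i _; rewrite setTI setIC.
by have := He 0%N (fun=> i) n B mB; rewrite E.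
Qed.

(** [nu] is a mere set function; its total mass is read off from the law of the first noise. *)
Lemma nu_setT mu I e : markov_chain P mu Q I -> iid_indep_noise P I e nu -> nu setT = 1.
Proof.
move=> cI ie.
have := @noise_rectE _ _ _ 1 (fun=> setT) cI ie (fun=> @borel_mxT _ _ _).
rewrite big_nat1 (_ : mkset _ = setT); last by apply/seteqP; split.
by rewrite [LHS](probability_setT P) => -[].
Qed.

Lemma noise_law mu I e n B : markov_chain P mu Q I -> iid_indep_noise P I e nu ->
  borel_mx B -> (0 < n)%N -> P (e n @^-1` B) = (nu B)%:E.
Proof.
move=> cI ie mB n0.
have := @noise_rectE _ _ _ n (fun k => if k == n then B else setT) cI ie.
rewrite (_ : mkset _ = e n @^-1` B); last first.
  apply/seteqP; split => t /=; first by move=> /(_ n); rewrite n0 leqnn eqxx; exact.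
  by move=> Bt k _; case: eqP => // ->.
move=> ->; last by move=> k; case: ifP => // _; exact: borel_mxT.
rewrite big_nat_recr //= eqxx big_nat big1 ?mul1r // => k /andP[_ kn].
by rewrite (ltn_eqF kn) (nu_setT cI ie).
Qed.

Lemma joint_law_shift mu I e : nu setT = 1 ->
  (forall k i, measurable [set t | I k t = i]) ->
  (forall k B, borel_mx B -> measurable (e k @^-1` B)) ->
  joint_law P mu Q nu I e ->
  joint_law P (mstep Q mu) Q nu (fun k => I k.+1) (fun k => e k.+1).
Proof.
move=> nuT mI me H n s B mB.
rewrite (measure_partition _ (V := I 0%N)) => [|i]; last first.
  apply: measurableI => //; apply: measurableI; first exact: (path_measurable (I := fun k => I k.+1)).
  by apply: (noise_event_measurable (e := fun k => e k.+1)) => // k B' mB'; exact: me.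
rewrite /mstep mulr_suml mulr_suml -sumEFin; apply: eq_bigr => i _.
pose s' k := if k is k'.+1 then s k' else i.
(* The noise of time 1 is left free, which costs the factor [nu setT] = 1. *)
pose B' k := if (1 < k)%N then B k.-1 else setT.
have mB' k : borel_mx (B' k) by rewrite /B'; case: ifP => // _; exact: borel_mxT.
have -> : path_rect (fun k => I k.+1) (fun k => e k.+1) n s B `&` [set t | I 0%N t = i] =
    path_rect I e n.+1 s' B'.
  apply/seteqP; split => t /=.
    move=> [[Hs HB] H0]; split => [[|k] //= kn|k /andP[k1 kn]].
      exact: Hs.
    rewrite /B'; case: ifP => // {}k1; case: k k1 kn => [//|k] k1 kn.
    by apply: HB; rewrite -ltnS k1 -ltnS.
  move=> [Hs HB]; split; last exact: (Hs 0%N).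
  split => [k kn|k /andP[k1 kn]]; first exact: (Hs k.+1).
  have h := HB k.+1; have k2 : (1 < k.+1)%N by rewrite ltnS.
  by rewrite /B' k2 in h; apply: h; rewrite ltnS.
apply: (eq_trans (H n.+1 s' B' mB')); rewrite big_ord_recl /= -!mulrA; congr (_ * (_ * (_ * _)))%:E.
rewrite /= [in LHS]big_ltn // /B' /= nuT mul1r big_add1 /=.
apply: eq_big_nat => k /andP[k1 _].
by rewrite ltnS k1.
Qed.

Lemma joint_law_iter_shift N mu I e : nu setT = 1 ->
  (forall k i, measurable [set t | I k t = i]) ->
  (forall k B, borel_mx B -> measurable (e k @^-1` B)) ->
  joint_law P mu Q nu I e ->
  joint_law P (iter N (mstep Q) mu) Q nu (fun k => I (N + k)%N) (fun k => e (N + k)%N).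
Proof.
move=> nuT mI me H; elim: N => [//|N IH].
have := @joint_law_shift _ (fun k => I (N + k)%N) (fun k => e (N + k)%N) nuT _ _ IH.
rewrite (_ : (fun k => I (N + k.+1)%N) = (fun k => I (N.+1 + k)%N)); last first.
  by apply/funext => k; rewrite addnS.
rewrite (_ : (fun k => e (N + k.+1)%N) = (fun k => e (N.+1 + k)%N)); last first.
  by apply/funext => k; rewrite addnS.
by apply => *; [exact: mI|exact: me].
Qed.

Lemma joint_law_path mu I e : nu setT = 1 -> joint_law P mu Q nu I e ->
  forall n s, P [set t | forall k, (k <= n)%N -> I k t = s k] =
     (mu (s 0%N) * \prod_(k < n) Q (s k) (s k.+1))%:E.
Proof.
move=> nuT H n s; have := H n s (fun=> setT) (fun=> @borel_mxT _ _ _).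
rewrite [X in (_ * X)%:E]big1 ?mulr1 // => <-; congr (P _); apply/seteqP; split => t /=.
  by move=> h; split.
by move=> [].
Qed.
End OneSpace.

Lemma reversed_chain_prod (Q : 'M[R]_r) (pi : 'I_r -> R) (s : nat -> 'I_r) n :
  (forall i, 0 < pi i) ->
  pi (s n) * \prod_(k < n) (pi (s k) * Q (s k) (s k.+1) / pi (s k.+1)) =
  pi (s 0%N) * \prod_(k < n) Q (s k) (s k.+1).
Proof.
move=> pi0; elim: n => [|n IH]; first by rewrite !big_ord0.
rewrite !big_ord_recr /= [RHS]mulrA -IH.
have := pi0 (s n.+1); rewrite lt0r => /andP[h _]; field.
exact: h.
Qed.

Definition reversed_kernel (Q : 'M[R]_r) (pi : 'I_r -> R) : 'M[R]_r :=
  \matrix_(i, j) (pi j * Q j i / pi i).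

Lemma stochastic_reversed Q pi : stochastic Q -> stationary Q pi -> (forall i, 0 < pi i) ->
  stochastic (reversed_kernel Q pi).
Proof.
move=> [Q0 Q1] [[p0 p1] pQ] pi0; split => [i j|i].
  by rewrite mxE divr_ge0 ?mulr_ge0.
under eq_bigr do rewrite mxE.
by rewrite -mulr_suml -pQ divff // gt_eqF.
Qed.

(** The ratios of pi in the reversed kernel telescope, and the noise factors are merely permuted.
    Reversal maps the regime times 0..n and the noise times 1..n onto themselves, whence [n - k] and
    [n.+1 - k]. *)
Lemma joint_law_reversed d (T : measurableType d) (P : probability T R) Q pi nu J e n :
  (forall i, 0 < pi i) -> joint_law P pi (reversed_kernel Q pi) nu J e ->
  forall s B, (forall k, borel_mx (B k)) ->
    P (path_rect (fun k => J (n - k)%N) (fun k => e (n.+1 - k)%N) n s B) =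
    (pi (s 0%N) * \prod_(k < n) Q (s k) (s k.+1) * \prod_(1 <= k < n.+1) nu (B k))%:E.
Proof.
move=> pi0 H s B mB.
have -> : path_rect (fun k => J (n - k)%N) (fun k => e (n.+1 - k)%N) n s B =
    path_rect J e n (fun k => s (n - k)%N) (fun k => B (n.+1 - k)%N).
  apply/seteqP; split => t /= [Hs HB]; split => k kn.
  - by rewrite -Hs ?leq_subr // subKn.
  - have := HB (n.+1 - k)%N; rewrite subKn; last by lia.
    by apply; lia.
  - by rewrite Hs ?leq_subr // subKn.
  - have := HB (n.+1 - k)%N; rewrite subKn; last by lia.
    by apply; lia.
rewrite H //; congr (_ * _)%:E.
  rewrite subn0 -(reversed_chain_prod _ _ _ pi0); congr (_ * _).
  rewrite (reindex_inj rev_ord_inj) /=; apply: eq_bigr => k _.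
  by rewrite mxE /= subnS subKn ?(ltn_ord k) // prednK // subnK.
rewrite [RHS]big_nat_rev /=; apply: eq_big_nat => k kn.
by congr (nu (B _)); lia.
Qed.

End JointLaw.

(** * Forward and backward recursions *)

Section Recursions.
Context {R : realType} {r p : nat}.
Variable alpha : 'I_r -> 'M[R]_p.
Implicit Types (J : nat -> 'I_r) (e : nat -> 'M[R]_(p, r)).

Lemma mprod_ext J J' n : (forall k, (1 <= k <= n)%N -> J k = J' k) ->
  mprod alpha J n = mprod alpha J' n.
Proof.
elim: n => [//|n IH] JJ /=; rewrite JJ ?ltnSn // IH // => k /andP[k0 kn].
by rewrite JJ // k0 leqW.
Qed.

Lemma Xseq_ext J J' e e' x n : (forall k, (1 <= k <= n)%N -> J k = J' k) ->
  (forall k, (1 <= k <= n)%N -> e k = e' k) ->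
  Xseq alpha J e x n = Xseq alpha J' e' x n.
Proof.
elim: n => [//|n IH] JJ ee /=; rewrite JJ ?ltnSn // ee ?ltnSn // IH // => k /andP[k0 kn].
- by rewrite JJ // k0 leqW.
- by rewrite ee // k0 leqW.
Qed.

Lemma Xseq_start J e x n :
  Xseq alpha J e x n = Xseq alpha J e 0 n + mprod alpha J n *m x.
Proof.
elim: n => [|n IH] /=; first by rewrite add0r mul1mx.
by rewrite IH mulmxDr mulmxA addrAC.
Qed.

Lemma XseqD J e x N n : Xseq alpha J e x (N + n) =
  Xseq alpha (fun k => J (N + k)%N) (fun k => e (N + k)%N) (Xseq alpha J e x N) n.
Proof. by elim: n => [|n IH]; rewrite ?addn0 // addnS /= IH addnS. Qed.

Fixpoint bprod J n : 'M[R]_p := if n is n'.+1 then bprod J n' *m alpha (J n') else 1%:M.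

Lemma bprod_front J n : bprod J n.+1 = alpha (J 0%N) *m bprod (fun k => J k.+1) n.
Proof.
elim: n => [|n IH]; first by rewrite /= mul1mx mulmx1.
by rewrite [LHS]/= -/(bprod J n.+1) IH /= mulmxA.
Qed.

Lemma bprodE J n : bprod J n = mprod alpha (fun k => J (n - k)%N) n.
Proof.
elim: n J => [//|n IH] J; rewrite bprod_front IH /= subnn; congr (_ *m _).
by apply: mprod_ext => k /andP[_ kn]; rewrite subSn.
Qed.

Definition bsum J e n : 'cV[R]_p := \sum_(0 <= m < n) bprod J m *m col (J m) (e m.+1).

Lemma bsum_front J e n : bsum J e n.+1 =
  alpha (J 0%N) *m bsum (fun k => J k.+1) (fun k => e k.+1) n + col (J 0%N) (e 1%N).
Proof.
rewrite /bsum big_nat_recl //= mul1mx addrC mulmx_sumr; congr (_ + _).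
by apply: eq_bigr => m _; rewrite -/(bprod J m.+1) bprod_front mulmxA.
Qed.

(* X_n started at 0 is a backward partial sum along the time-reversed data. *)
Lemma bsumE J e n :
  Xseq alpha (fun k => J (n - k)%N) (fun k => e (n.+1 - k)%N) 0 n = bsum J e n.
Proof.
elim: n J e => [|n IH] J e; first by rewrite /bsum big_nil.
rewrite bsum_front -IH /= subnn subSnn; congr (_ *m _ + _).
by apply: Xseq_ext => k /andP[_ kn]; rewrite subSn // leqW.
Qed.
End Recursions.

(** The chain [I] is replaced by a chain J on a factor of its own; the product supplies
    independence, and the marginal law of the noise is kept. *)
Lemma joint_law_product (R : realType) (r p : nat)
    d1 (T1 : measurableType d1) (P1 : probability T1 R)
    d2 (T2 : measurableType d2) (P2 : probability T2 R)
    (mu pi : 'I_r -> R) (Q Q' : 'M[R]_r) (nu : set 'M[R]_(p, r) -> R)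
    (J : nat -> T1 -> 'I_r) (I : nat -> T2 -> 'I_r) (e : nat -> T2 -> 'M[R]_(p, r)) :
  markov_chain P1 pi Q' J -> markov_chain P2 mu Q I -> iid_indep_noise P2 I e nu ->
  joint_law (P1 \x P2)%E pi Q' nu (fun k x => J k x.1) (fun k x => e k x.2).
Proof.
move=> [mJ HJ] cI ie n s B mB.
have me := ie.1.
have -> : path_rect (fun k (x : T1 * T2) => J k x.1) (fun k x => e k x.2) n s B =
   [set t | forall k, (k <= n)%N -> J k t = s k] `*`
   [set t | forall k, (1 <= k <= n)%N -> B k (e k t)] by [].
apply: (eq_trans (product_measure1E _ _ _ _)).
- exact: path_measurable.
- exact: noise_event_measurable.
- by rewrite [X in (X * _)%E](HJ n s) [X in (_ * X)%E](noise_rectE n cI ie mB) -EFinM.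
Qed.

Section TailEvents.
Context {R : realType} {r p : nat} d (T : measurableType d) (P : probability T R).
Variables (Q : 'M[R]_r) (alpha : 'I_r -> 'M[R]_p) (tau rho C : R).
Hypothesis tail : forall n i,
  Epath Q n i (fun s => (tau ^+ n < `|lprod alpha s|)%R%:R) <= C * rho ^+ n.

Lemma mprod_tail_event (mu : 'I_r -> R) (V : nat -> T -> 'I_r) n :
  prob_vector mu -> (forall n i, measurable [set t | V n t = i]) ->
  (forall s, P [set t | forall k, (k <= n)%N -> V k t = s k] =
     (mu (s 0%N) * \prod_(k < n) Q (s k) (s k.+1))%:E) ->
  (P [set t | (tau ^+ n < `|mprod alpha (V ^~ t) n|)%R] <= (C * rho ^+ n)%:E)%E.
Proof.
move=> [mu0 mu1] mV lawV.
have -> : [set t | tau ^+ n < `|mprod alpha (V ^~ t) n|] =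
    [set t | tau ^+ n < `|lprod alpha [seq V k t | k <- iota 1 n]|].
  by apply/seteqP; split => t /=; rewrite mprodE.
rewrite [P _](path_eventE mV lawV (fun s => tau ^+ n < `|lprod alpha s|)).
rewrite lee_fin (_ : C * rho ^+ n = \sum_i mu i * (C * rho ^+ n)); last by rewrite -mulr_suml mu1 mul1r.
by apply: ler_sum => i _; apply: ler_wpM2l => //; exact: tail.
Qed.
End TailEvents.

Lemma borel_cantelli_ae d (T : measurableType d) (R : realType) (P : probability T R)
    (F : nat -> set T) :
  (forall n, measurable (F n)) -> (\sum_(n <oo) P (F n) < +oo)%E ->
  {ae P, forall t, exists N, forall n, (N <= n)%N -> ~ F n t}.
Proof.
move=> mF sF; have L0 := lim_sup_set_cvg0 mF sF.
exists (lim_sup_set F); split => //.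
  by apply: bigcap_measurable => // n _; exact: bigcup_measurable.
move=> t /= H n _; apply: contrapT => nF; apply: H; exists n => k nk Fk.
by apply: nF; exists k.
Qed.

Lemma geometric_sum_fin d (T : measurableType d) (R : realType) (P : probability T R)
    (F : nat -> set T) (C rho : R) : 0 <= C -> 0 < rho < 1 ->
  (forall n, P (F n) <= (C * rho ^+ n)%:E)%E -> (\sum_(n <oo) P (F n) < +oo)%E.
Proof.
move=> C0 /andP[r0 r1] HF.
apply: (@le_lt_trans _ _ (C / (1 - rho))%:E); last exact: ltry.
apply: lime_le; first by apply: is_cvg_nneseries => *; exact: measure_ge0.
apply: nearW => n; apply: (@le_trans _ _ (\sum_(0 <= k < n) (C * rho ^+ k)%:E)%E).
  by apply: lee_sum => k _.
rewrite sumEFin lee_fin -mulr_sumr ler_wpM2l //.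
rewrite -[leRHS]mul1r ler_pdivlMr ?subr_gt0 // big_mkord.
have -> : (\sum_(i < n) rho ^+ i) * (1 - rho) = 1 - rho ^+ n.
  by rewrite mulrC -opprB mulNr -subrX1 opprB.
by rewrite gerBl exprn_ge0 // ltW.
Qed.

(* The sum is at most E W / L + 1. *)
Lemma sum_tail_fin d (T : measurableType d) (R : realType) (P : probability T R)
    (W : T -> R) (L : R) : 0 < L -> measurable_fun setT W -> (forall t, 0 <= W t) ->
  (\int[P]_t (W t)%:E < +oo)%E ->
  (\sum_(n <oo) P [set t | (n%:R * L < W t)%R] < +oo)%E.
Proof.
move=> L0 mW W0 fW.
apply: (@le_lt_trans _ _ (\int[P]_t ((L^-1)%:E * (W t)%:E + 1))%E); last first.
  rewrite ge0_integralD //; last 2 first.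
  - by move=> t _; rewrite -EFinM lee_fin mulr_ge0 // invr_ge0 ltW.
  - by apply: emeasurable_funM => //; exact/measurable_EFinP.
  rewrite ge0_integralZl //; last 3 first.
  - exact/measurable_EFinP.
  - by move=> t _; rewrite lee_fin.
  - by rewrite lee_fin invr_ge0 ltW.
  rewrite lte_add_pinfty //.
    by rewrite lte_mul_pinfty // lee_fin invr_ge0 ltW.
  rewrite integral_cst // mul1e; apply: le_lt_trans (ltry 1); exact: probability_le1.
have mF n : measurable [set t | (n%:R * L < W t)%R] by exact: measurable_gt.
apply: lime_le; first by apply: is_cvg_nneseries => *; exact: measure_ge0.
apply: nearW => n.
have -> : (\sum_(0 <= k < n) P [set t | (k%:R * L < W t)%R] =
    \sum_(0 <= k < n) \int[P]_t (\1_[set t | (k%:R * L < W t)%R] t)%:E)%E.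
  by apply: eq_bigr => k _; rewrite integral_indic // setIT.
rewrite -ge0_integral_sum //; last first.
  by move=> k; apply/measurable_EFinP; exact: measurable_indic.
apply: ge0_le_integral => //.
- by move=> t _; apply: sume_ge0 => k _; rewrite lee_fin.
- by apply: emeasurable_sum => k; apply/measurable_EFinP; exact: measurable_indic.
- apply: emeasurable_funD => //; apply: emeasurable_funM => //; exact/measurable_EFinP.
move=> t _; rewrite sumEFin -EFinM -EFinD lee_fin.
have x0 : 0 <= L^-1 * W t by rewrite mulr_ge0 // invr_ge0 ltW.
(* The trivial bound by n is carried along: when the indicator of index n is 1, n < W / L, so the
   earlier terms add up to at most W / L and the new one fits into the + 1. *)
suff : \sum_(0 <= k < n) \1_[set t | (k%:R * L < W t)%R] t <= n%:R :> R /\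
       \sum_(0 <= k < n) \1_[set t | (k%:R * L < W t)%R] t <= L^-1 * W t + 1 by case.
elim: n => [|n [IH1 IH2]]; first by rewrite big_nil; split => //; exact: addr_ge0.
rewrite big_nat_recr //= indicE; case: (boolP (_ \in _)) => [/set_mem /= h|_]; last first.
  by rewrite addr0; split => //; apply: le_trans IH1 _; rewrite ler_nat.
split; first by rewrite -[n.+1%:R]natr1 lerD.
by apply: lerD => //; apply: le_trans IH1 _; rewrite ler_pdivlMl // mulrC ltW.
Qed.

(** * The backward series *)

Lemma cvg_series_geometric_bound (R : realType) (a : nat -> R) (M kappa : R) N :
  0 <= M -> 0 < kappa < 1 -> (forall n, (N <= n)%N -> `|a n| <= M * kappa ^+ n) ->
  cvgn (series a).
Proof.
move=> M0 /andP[k0 k1] Ha.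
pose M' := \big[Num.max/M]_(m < N) (`|a m| / kappa ^+ m).
have MM' : M <= M' by exact: bigmax_ge_id.
have Ha' n : `|a n| <= M' * kappa ^+ n.
  case: (leqP N n) => nN.
    by apply: le_trans (Ha n nN) _; rewrite ler_wpM2r // exprn_ge0 // ltW.
  rewrite -ler_pdivrMr ?exprn_gt0 //.
  exact: (le_bigmax M (fun m : 'I_N => `|a m| / kappa ^+ m) (Ordinal nN)).
apply: normed_cvg; apply: (@series_le_cvg _ _ (geometric M' kappa)).
- by move=> n; exact: normr_ge0.
- by move=> n; rewrite /geometric /= mulr_ge0 ?exprn_ge0 ?(ltW k0) //; exact: le_trans MM'.
- exact: Ha'.
- by apply: is_cvg_geometric_series; rewrite ger0_norm // ltW.
Qed.

Lemma cvg_mx_entries (R : realType) m n (A : nat -> 'M[R]_(m, n)) (L : 'M[R]_(m, n)) :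
  (forall i j, A k i j @[k --> \oo] --> L i j) -> A k @[k --> \oo] --> L.
Proof.
move=> H; apply/cvgrPdist_le => e e0; near=> k.
apply: mx_norm_le; first exact: ltW.
move=> i j; rewrite !mxE.
have : forall ij : 'I_m * 'I_n, `|L ij.1 ij.2 - A k ij.1 ij.2| <= e.
  move=> ij; move: ij; near: k; apply: filter_forall => ij.
  exact: ((cvgrPdist_le _ _).1 (H _ _)).
by move=> /(_ (i, j)).
Unshelve. all: by end_near. Qed.

Section Backward.
Context {R : realType} {r p : nat} d (T : measurableType d) (P : probability T R).
Variables (alpha : 'I_r -> 'M[R]_p) (J : nat -> T -> 'I_r) (e : nat -> T -> 'M[R]_(p, r)).
Hypothesis mJ : forall k i, measurable [set t | J k t = i].
Hypothesis me : forall k, random_mx (e k).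

Lemma random_mx_bprod n : random_mx (fun t => bprod alpha (J ^~ t) n).
Proof.
elim: n => [|n IH] /=; first exact: random_mx_cst.
apply: random_mxM => //.
by apply: (random_mx_select (X := fun=> alpha)) => // i; exact: random_mx_cst.
Qed.

Lemma random_mx_bsum n : random_mx (fun t => bsum alpha (J ^~ t) (e ^~ t) n).
Proof.
elim: n => [|n IH].
  rewrite (_ : (fun _ => _) = fun=> 0); first exact: random_mx_cst.
  by apply/funext => t; rewrite /bsum big_nil.
rewrite (_ : (fun _ => _) = (fun t => bsum alpha (J ^~ t) (e ^~ t) n +
    bprod alpha (J ^~ t) n *m col (J n t) (e n.+1 t))).
  apply: random_mxD => //; apply: random_mxM; first exact: random_mx_bprod.
  exact: random_mx_col.
by apply/funext => t; rewrite /bsum big_nat_recr.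
Qed.

Definition logp_col (i : 'I_r) (A : 'M[R]_(p, r)) : R := Num.max (ln `|col i A|) 0.

Lemma measurable_logp_col i (X : T -> 'M[R]_(p, r)) : random_mx X ->
  measurable_fun setT (fun t => logp_col i (X t)).
Proof.
move=> mX; apply: measurable_maxr => //; apply: measurableT_comp => //.
have mc : random_mx (fun t => col i (X t)).
  by move=> k j; under eq_fun do rewrite mxE; exact: mX.
apply: (measurable_cont_random_mx (f := fun A : 'cV[R]_p => `|A|) mc).
by move=> A; exact: norm_continuous.
Qed.

(* By Borel-Cantelli, almost surely |bprod J n| <= tau^n and |col i (e n.+1)| <= tau^(-n/2)
   for all large n, so the terms of bsum decay geometrically. *)
Lemma backward_limit (tau rho C : R) :
  0 < tau < 1 -> 0 < rho < 1 -> 0 <= C ->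
  (forall n, P [set t | (tau ^+ n < `|bprod alpha (J ^~ t) n|)%R] <= (C * rho ^+ n)%:E)%E ->
  (forall (L : R) i, 0 < L ->
    (\sum_(n <oo) P [set t | (n%:R * L < logp_col i (e n.+1 t))%R] < +oo)%E) ->
  exists Y : T -> 'cV[R]_p, random_mx Y /\
    {ae P, forall t, bsum alpha (J ^~ t) (e ^~ t) n @[n --> \oo] --> Y t}.
Proof.
move=> /andP[t0 t1] rho01 C0 HA HB.
(* An upper limit exists at every t, so Y is measurable whatever the set of convergence; [fine]
   gives it a value where the upper limit is infinite. *)
pose Y t : 'cV[R]_p :=
  \col_i fine (limn_esup (fun n => (bsum alpha (J ^~ t) (e ^~ t) n i 0)%:E)).
exists Y; split.
  move=> i j; rewrite (_ : (fun _ => _) =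
    fun t => fine (limn_esup (fun n => (bsum alpha (J ^~ t) (e ^~ t) n i 0)%:E))); last first.
    by apply/funext => t; rewrite mxE.
  apply: measurableT_comp => //.
  apply: (measurable_fun_limn_esup (f := fun n t => (bsum alpha (J ^~ t) (e ^~ t) n i 0)%:E)) => n.
  by apply/measurable_EFinP; exact: random_mx_bsum.
(* The root splits tau^m into k^m k^m: one factor pays for a noise of size at most k^-m, that is of
   logarithm at most m L, and the other remains. *)
pose k := Num.sqrt tau.
have k0 : 0 < k by rewrite sqrtr_gt0.
have kk : k * k = tau by rewrite -expr2 sqr_sqrtr // ltW.
have k1 : k < 1 by rewrite -sqrtr1 ltr_sqrt.
pose L := - ln k.
have L0 : 0 < L by rewrite /L oppr_gt0 ln_lt0 // k0.
have aeA : {ae P, forall t, exists N, forall n, (N <= n)%N ->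
    ~ (tau ^+ n < `|bprod alpha (J ^~ t) n|)}.
  apply: (borel_cantelli_ae (F := fun n => [set t | tau ^+ n < `|bprod alpha (J ^~ t) n|])).
    by move=> n; apply: measurable_norm_gt; exact: random_mx_bprod.
  exact: geometric_sum_fin HA.
have aeB i : {ae P, forall t, exists N, forall n, (N <= n)%N ->
    ~ (n%:R * L < logp_col i (e n.+1 t))}.
  apply: (borel_cantelli_ae (F := fun n => [set t | n%:R * L < logp_col i (e n.+1 t)])).
    by move=> n; apply: measurable_gt; exact: measurable_logp_col.
  exact: HB.
have aeB' : {ae P, forall t, forall i, exists N, forall n, (N <= n)%N ->
    ~ (n%:R * L < logp_col i (e n.+1 t))}.
  exact: filter_forall.
apply: filterS2 aeA aeB' => t [NA HNA] HNB.
have [NB HNB'] := choice HNB.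
pose N := (NA + \max_i NB i)%N.
pose term m := bprod alpha (J ^~ t) m *m col (J m t) (e m.+1 t).
have Hterm m : (N <= m)%N -> `|term m| <= p%:R * k ^+ m.
  move=> Nm; apply: le_trans (mx_norm_mul _ _) _; apply: ler_wpM2l => //.
  have hA : `|bprod alpha (J ^~ t) m| <= tau ^+ m.
    by rewrite leNgt; apply/negP; apply: HNA; apply: leq_trans Nm; rewrite leq_addr.
  have hB : `|col (J m t) (e m.+1 t)| <= k ^- m.
    have : logp_col (J m t) (e m.+1 t) <= m%:R * L.
      rewrite leNgt; apply/negP; apply: HNB'; apply: leq_trans Nm.
      by rewrite (leq_trans (leq_bigmax (J m t))) // leq_addl.
    rewrite /logp_col ge_max => /andP[+ _].
    have [->|x0] := eqVneq `|col (J m t) (e m.+1 t)| 0.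
      by move=> _; rewrite invr_ge0 exprn_ge0 // ltW.
    have x1 : 0 < `|col (J m t) (e m.+1 t)| by rewrite lt_def x0 /=.
    move=> h; rewrite -[leLHS]lnK ?posrE // -exprVn -[k^-1]lnK ?posrE ?invr_gt0 //.
    by rewrite lnV ?posrE // -expRM_natl ler_expR.
  apply: (le_trans (ler_pM _ _ hA hB)) => //.
  by rewrite -kk exprMn mulfK // gt_eqF // exprn_gt0.
apply: cvg_mx_entries => i j.
have -> : Y t i j = fine (limn_esup (fun n => (bsum alpha (J ^~ t) (e ^~ t) n i 0)%:E)).
  by rewrite mxE.
have cv : cvgn (series (fun m => term m i 0)).
  apply: (@cvg_series_geometric_bound _ _ p%:R k N) => //; first by rewrite k0.
  by move=> n Nn; apply: le_trans (Hterm n Nn); exact: mx_entry_le.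
have sE : series (fun m => term m i 0) = (fun n => bsum alpha (J ^~ t) (e ^~ t) n i 0).
  by apply/funext => n; rewrite /series /= /bsum summxE.
rewrite sE in cv.
rewrite (ord1 j).
have [l Hl] := (cvg_ex _).1 cv.
have El : (bsum alpha (J ^~ t) (e ^~ t) n i 0)%:E @[n --> \oo] --> l%:E.
  by apply: cvg_EFin => //; exact: nearW.
by rewrite (cvg_limn_einf_sup El).2.
Qed.
End Backward.

(** * Convergence in distribution *)

Section InfConvolution.
Context {R : realType} {p : nat}.
Variables (f : 'cV[R]_p -> R) (M : R).
Hypothesis fM : forall x, `|f x| <= M.

(** The Pasch-Hausdorff envelope: the largest k-Lipschitz function below the bounded f. *)
Definition infconv (k : nat) (x : 'cV[R]_p) : R :=
  inf [set f y + k%:R * `|x - y| | y in setT].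

Lemma infconv_has_inf k x : has_inf [set f y + k%:R * `|x - y| | y in setT].
Proof.
split; first by exists (f x + k%:R * `|x - x|); exists x.
exists (- M) => _ [y _ <-]; have := fM y; rewrite ler_norml => /andP[h _].
by rewrite -[leLHS]addr0 lerD // mulr_ge0.
Qed.

Lemma infconv_le k x y : infconv k x <= f y + k%:R * `|x - y|.
Proof. by apply: ge_inf; [case: (infconv_has_inf k x)|exists y]. Qed.

Lemma le_infconv k x c : (forall y, c <= f y + k%:R * `|x - y|) -> c <= infconv k x.
Proof.
move=> H; apply: lb_le_inf; first by case: (infconv_has_inf k x).
by move=> _ [y _ <-].
Qed.

Lemma infconv_bound k x : `|infconv k x| <= M.
Proof.
rewrite ler_norml; apply/andP; split.
  apply: le_infconv => y; have := fM y; rewrite ler_norml => /andP[h _].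
  by rewrite -[leLHS]addr0 lerD // mulr_ge0.
apply: le_trans (infconv_le k x x) _; rewrite subrr normr0 mulr0 addr0.
by have := fM x; rewrite ler_norml => /andP[].
Qed.

Lemma infconv_lipschitz k x y : `|infconv k x - infconv k y| <= k%:R * `|x - y|.
Proof.
have H u v : infconv k u - infconv k v <= k%:R * `|u - v|.
  rewrite lerBlDr -lerBlDl; apply: le_infconv => z; rewrite lerBlDl.
  apply: le_trans (infconv_le k u z) _; rewrite addrCA lerD2l -mulrDr ler_wpM2l //.
  by rewrite (le_trans _ (ler_normD _ _)) // addrA subrK.
by rewrite ler_norml H andbT lerNl opprB distrC H.
Qed.

(** Near x, f is at least f x - e by continuity; at distance dl or more, the penalty k dl >= 2M
    outweighs the oscillation of f. *)
Lemma infconv_cvg x : {for x, continuous f} -> infconv k x @[k --> \oo] --> f x.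
Proof.
move=> cf; apply/cvgrPdist_le => e e0.
have [dl /= d0 Hd] : nbhs_ball x [set y | `|f x - f y| <= e].
  by apply/nbhs_ballP; exact: ((cvgrPdist_le _ _).1 cf e e0).
near=> k.
have kd : M *+ 2 <= k%:R * dl.
  rewrite -ler_pdivrMr //; near: k; exact: nbhs_infty_ger.
rewrite ger0_norm; last first.
  by rewrite subr_ge0; have := infconv_le k x x; rewrite subrr normr0 mulr0 addr0.
rewrite lerBlDr -lerBlDl; apply: le_infconv => y.
have [xy|xy] := ltP `|x - y| dl.
  have : `|f x - f y| <= e by apply: Hd; rewrite -ball_normE.
  move=> /(le_trans (ler_norm _)) h.
  apply: (@le_trans _ _ (f y)); first by lra.
  by rewrite lerDl mulr_ge0.
have h1 : k%:R * dl <= k%:R * `|x - y| by rewrite ler_wpM2l.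
have := fM x; have := fM y; rewrite !ler_norml => /andP[h2 _] /andP[_ h3].
move: kd; rewrite mulr2n => kd; lra.
Unshelve. all: by end_near. Qed.

End InfConvolution.

Lemma lipschitz_continuous_mx (R : realType) (p : nat) (f : 'cV[R]_p -> R) (L : R) :
  (forall x y, `|f x - f y| <= L * `|x - y|) -> continuous f.
Proof.
move=> fL x; apply: (@cvgrPdist_le _ _ _ _ (nbhs_filter x) f (f x)).2 => e e0.
have L1 : 0 < `|L| + 1 by rewrite ltr_wpDl.
apply/nbhs_ballP; exists (e / (`|L| + 1)) => [|y]; first exact: divr_gt0.
rewrite -ball_normE /= ltr_pdivlMr // => xy; apply: le_trans (fL x y) _.
apply: le_trans (ltW xy); rewrite mulrC ler_wpM2l //.
by rewrite (le_trans (ler_norm _)) // lerDl.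
Qed.

Lemma bounded_convergence d (T : measurableType d) (R : realType) (P : probability T R)
    (f_ : nat -> T -> R) (f : T -> R) M :
  (forall n, measurable_fun setT (f_ n)) -> measurable_fun setT f ->
  (forall n t, `|f_ n t| <= M) -> {ae P, forall t, f_ n t @[n --> \oo] --> f t} ->
  \int[P]_t f_ n t @[n --> \oo] --> \int[P]_t f t.
Proof.
move=> mf_ mf fM cf.
have [fi _ h] : [/\ P.-integrable setT (EFin \o f),
    [sequence \int[P]_t (`|(f_ n t)%:E - (f t)%:E|)]_n%E @ \oo --> 0%E &
    (\int[P]_t (f_ n t)%:E)%E @[n --> \oo] --> (\int[P]_t (f t)%:E)%E].
  apply: (@dominated_convergence _ _ _ P setT measurableT (fun n t => (f_ n t)%:E)
      (EFin \o f) (fun=> M%:E)).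
  - by move=> n; apply/measurable_EFinP.
  - exact/measurable_EFinP.
  - apply: filterS cf => t cft _; apply: cvg_EFin; last exact: cft.
    exact: nearW.
  - by apply: (@bounded_integrable _ _ _ P (fun=> M) `|M|).
  - by apply: aeW => t n _; rewrite lee_fin.
apply: fine_cvg; rewrite fineK //.
exact: integrable_fin_num fi.
Qed.

(* f is the increasing limit of its Lipschitz inf-convolutions; this bounds the lower
   limit of the integrals of f, and the same for - f bounds the upper limit. *)
Lemma portmanteau_lipschitz (R : realType) (p : nat)
    d (T : measurableType d) (P : probability T R)
    d' (T' : measurableType d') (P' : probability T' R)
    (X : nat -> T -> 'cV[R]_p) (Y : T' -> 'cV[R]_p) :
  (forall n, random_mx (X n)) -> random_mx Y ->
  (forall f : 'cV[R]_p -> R, (exists M, forall x, `|f x| <= M) ->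
     (exists L, forall x y, `|f x - f y| <= L * `|x - y|) ->
     \int[P]_t f (X n t) @[n --> \oo] --> \int[P']_t f (Y t)) ->
  forall f : 'cV[R]_p -> R, bcont f ->
     \int[P]_t f (X n t) @[n --> \oo] --> \int[P']_t f (Y t).
Proof.
move=> mX mY H.
have lower (f : 'cV[R]_p -> R) : bcont f -> forall e, 0 < e ->
    \forall n \near \oo, \int[P']_t f (Y t) - e <= \int[P]_t f (X n t).
  move=> [cf [M fM]] e e0.
  have mg k : continuous (infconv f k) by exact: lipschitz_continuous_mx (infconv_lipschitz fM k).
  have gY : \int[P']_t infconv f k (Y t) @[k --> \oo] --> \int[P']_t f (Y t).
    apply: (bounded_convergence (M := M)).
    - by move=> k; exact: measurable_cont_random_mx mY (mg k).
    - exact: measurable_cont_random_mx mY cf.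
    - by move=> k t; exact: infconv_bound.
    - by apply: aeW => t; apply: (infconv_cvg fM); exact: cf.
  have [k _ Hk] := (cvgrPdist_le _ _).1 gY (e / 2) (divr_gt0 e0 (ltr0Sn R 1)).
  have := H (infconv f k) (ex_intro _ M (infconv_bound fM k))
    (ex_intro _ k%:R (infconv_lipschitz fM k)).
  move=> /cvgrPdist_le/(_ (e / 2) (divr_gt0 e0 (ltr0Sn R 1))).
  apply: filterS => n Hn.
  have le : \int[P]_t infconv f k (X n t) <= \int[P]_t f (X n t).
    apply: le_Rintegral => //.
    - exact: bounded_integrable (measurable_cont_random_mx (mX n) (mg k)) (fun t => infconv_bound fM k _).
    - exact: bounded_integrable (measurable_cont_random_mx (mX n) cf) (fun t => fM _).
    - by move=> t _; have := infconv_le fM k (X n t) (X n t); rewrite subrr normr0 mulr0 addr0.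
  have := Hk k (leqnn k) => /=; move: Hn; rewrite !ler_norml => /andP[h1 h2] /andP[h3 h4].
  lra.
move=> f [cf [M fM]]; apply/cvgrPdist_le => e e0.
have bN : bcont (fun x => - f x).
  split; last by exists M => x; rewrite normrN.
  move=> x; exact: (@cvgN _ _ _ _ (nbhs_filter x) f _ (cf x)).
have N1 : \int[P']_t (- f (Y t)) = - \int[P']_t f (Y t).
  under eq_Rintegral do rewrite -mulN1r.
  rewrite RintegralZl ?mulN1r //.
  exact: bounded_integrable (measurable_cont_random_mx mY cf) (fun t => fM _).
have N2 n : \int[P]_t (- f (X n t)) = - \int[P]_t f (X n t).
  under eq_Rintegral do rewrite -mulN1r.
  rewrite RintegralZl ?mulN1r //.
  exact: bounded_integrable (measurable_cont_random_mx (mX n) cf) (fun t => fM _).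
have bf : bcont f by split => //; exists M.
apply: filterS2 (lower f bf e e0) (lower _ bN e e0) => n h1 h2.
move: h2; rewrite N1 N2 => h2; rewrite ler_norml; lra.
Qed.

(** * Loss of memory of the initial state *)

Section Forget.
Context {R : realType} {r p : nat} d (T : measurableType d) (P : probability T R).
Variables (Q : 'M[R]_r) (alpha : 'I_r -> 'M[R]_p) (tau rho C : R).
Hypothesis sQ : stochastic Q.
Hypotheses (tau01 : 0 < tau < 1) (rho01 : 0 < rho < 1) (C0 : 0 <= C).
Hypothesis tail : forall n i,
  Epath Q n i (fun s => (tau ^+ n < `|lprod alpha s|)%R%:R) <= C * rho ^+ n.

Lemma random_mx_mprod (V : nat -> T -> 'I_r) n :
  (forall n i, measurable [set t | V n t = i]) ->
  random_mx (fun t => mprod alpha (V ^~ t) n).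
Proof.
move=> mV; elim: n => [|n IH] /=; first exact: random_mx_cst.
apply: random_mxM => //.
by apply: (random_mx_select (X := fun=> alpha)) => // i; exact: random_mx_cst.
Qed.

Lemma mprod_cvg0 (mu : 'I_r -> R) (V : nat -> T -> 'I_r) :
  prob_vector mu -> (forall n i, measurable [set t | V n t = i]) ->
  (forall n s, P [set t | forall k, (k <= n)%N -> V k t = s k] =
     (mu (s 0%N) * \prod_(k < n) Q (s k) (s k.+1))%:E) ->
  {ae P, forall t, `|mprod alpha (V ^~ t) n| @[n --> \oo] --> 0}.
Proof.
move=> pmu mV lawV; have [t0 t1] := andP tau01.
have : {ae P, forall t, exists N, forall n, (N <= n)%N ->
    ~ (tau ^+ n < `|mprod alpha (V ^~ t) n|)}.
  apply: (borel_cantelli_ae (F := fun n => [set t | tau ^+ n < `|mprod alpha (V ^~ t) n|])).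
    by move=> n; apply: measurable_norm_gt; exact: random_mx_mprod.
  apply: (geometric_sum_fin C0 rho01) => n.
  exact: (mprod_tail_event tail pmu mV (lawV n)).
apply: filterS => t [N HN].
apply: (@squeeze_cvgr _ _ _ _ (fun=> 0) (fun n => tau ^+ n)).
- near=> n; rewrite normr_ge0 /= leNgt; apply/negP; apply: HN.
  by near: n; exists N.
- exact: cvg_cst.
- by apply: cvg_expr; rewrite ger0_norm // ltW.
Unshelve. all: by end_near. Qed.

(** With the same regimes and noises after time N, the two processes differ by a product of matrices
    applied to X_N, which tends to 0 almost surely. The difference converges but neither process
    need do so, so plain continuity of f would not suffice: hence the Lipschitz test functions. *)
Lemma forget_start (mu : 'I_r -> R) nu (I : nat -> T -> 'I_r)
    (e : nat -> T -> 'M[R]_(p, r)) (X0 : T -> 'cV[R]_p) (f : 'cV[R]_p -> R) (M L : R) N :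
  prob_vector mu -> nu setT = 1 ->
  (forall n i, measurable [set t | I n t = i]) ->
  (forall k B, borel_mx B -> measurable (e k @^-1` B)) ->
  joint_law P mu Q nu I e -> random_mx X0 ->
  (forall x, `|f x| <= M) -> (forall x y, `|f x - f y| <= L * `|x - y|) ->
  \int[P]_t f (Xseq alpha (I ^~ t) (e ^~ t) (X0 t) (N + n)) -
  \int[P]_t f (Xseq alpha (fun k => I (N + k)%N t) (fun k => e (N + k)%N t) 0 n)
    @[n --> \oo] --> 0.
Proof.
move=> pmu nuT mI me law mX0 fM fL.
have cf := lipschitz_continuous_mx fL.
have re k : random_mx (e k) by apply: borel_random_mx; exact: me.
pose X n t := Xseq alpha (I ^~ t) (e ^~ t) (X0 t) n.
pose XN n t := Xseq alpha (fun k => I (N + k)%N t) (fun k => e (N + k)%N t) 0 n.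
have mX n : random_mx (X n) by exact: random_mx_Xseq.
have mXN n : random_mx (XN n).
  apply: (@random_mx_Xseq R _ T r p alpha (fun k => I (N + k)%N) (fun k => e (N + k)%N) (fun=> 0)).
  - by move=> k i; exact: mI.
  - by move=> k _; exact: re.
  - exact: random_mx_cst.
have mfX n := measurable_cont_random_mx (mX n) cf.
have mfXN n := measurable_cont_random_mx (mXN n) cf.
have E n : \int[P]_t f (X (N + n)%N t) - \int[P]_t f (XN n t) =
    \int[P]_t (f (X (N + n)%N t) - f (XN n t)).
  rewrite RintegralB //.
  - exact: bounded_integrable (mfX _) (fun t => fM _).
  - exact: bounded_integrable (mfXN _) (fun t => fM _).
under eq_fun do rewrite E.
suff : \int[P]_t (f (X (N + n)%N t) - f (XN n t)) @[n --> \oo] --> \int[P]_(t in setT) (0 : R).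
  by rewrite Rintegral_cstT.
apply: (bounded_convergence (M := M + M)) => //.
- by move=> n; exact: measurable_funB.
- by move=> n t; apply: le_trans (ler_normB _ _) _; exact: lerD.
have pN := iter_mstep_prob N sQ pmu.
have lawN := joint_law_path nuT (joint_law_iter_shift N nuT mI me law).
have := mprod_cvg0 (V := fun k => I (N + k)%N) pN (fun n => mI (N + n)%N) lawN.
apply: filterS => t Ht; apply/norm_cvg0P.
apply: (@squeeze_cvgr _ _ _ _ (fun=> 0)
   (fun n => (`|L| * p%:R * `|X N t|) * `|mprod alpha (fun k => I (N + k)%N t) n|)).
- apply: nearW => n; rewrite normr_ge0 /=.
  rewrite /X XseqD -/(X N t) Xseq_start -/(XN n t).
  apply: le_trans (fL _ _) _; rewrite addrAC subrr add0r.
  apply: le_trans (ler_wpM2r (normr_ge0 _) (ler_norm L)) _.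
  rewrite -!mulrA ler_wpM2l // [`|X N t| * _]mulrC; exact: mx_norm_mul.
- exact: cvg_cst.
- suff : `|L| * p%:R * `|X N t| * `|mprod alpha (fun k => I (N + k)%N t) n|
      @[n --> \oo] --> `|L| * p%:R * `|X N t| * 0 by rewrite mulr0.
  exact: cvgMr.
Qed.
End Forget.

(** Both path laws have transition kernel Q once J is reversed, so their density is mu / pi at the
    initial regime. The reversed run is the backward sum, and the bound is uniform in n. *)
Lemma joint_law_compare (R : realType) (r p : nat)
    d (T : measurableType d) (P : probability T R)
    d' (T' : measurableType d') (P' : probability T' R)
    (Q : 'M[R]_r) (alpha : 'I_r -> 'M[R]_p) (nu : set 'M[R]_(p, r) -> R)
    (mu pi : 'I_r -> R) (I : nat -> T -> 'I_r) (e : nat -> T -> 'M[R]_(p, r))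
    (J : nat -> T' -> 'I_r) (e' : nat -> T' -> 'M[R]_(p, r))
    (f : 'cV[R]_p -> R) (M eps : R) n :
  prob_vector mu -> (forall i, 0 < pi i) ->
  (forall n i, measurable [set t | I n t = i]) ->
  (forall k B, borel_mx B -> measurable (e k @^-1` B)) ->
  (forall n i, measurable [set t | J n t = i]) ->
  (forall k B, borel_mx B -> measurable (e' k @^-1` B)) ->
  joint_law P mu Q nu I e ->
  joint_law P' pi (reversed_kernel Q pi) nu J e' ->
  continuous f -> (forall x, `|f x| <= M) ->
  (forall i, `|mu i / pi i - 1| <= eps) ->
  `|\int[P]_t f (Xseq alpha (I ^~ t) (e ^~ t) 0 n) -
    \int[P']_t f (bsum alpha (J ^~ t) (e' ^~ t) n)| <= eps * (M *+ 2).
Proof.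
move=> pmu pi0 mI me mJ me' law law' cf fM ceps.
have c0 i : 0 <= mu i / pi i by rewrite divr_ge0 ?pmu.1 // ltW.
have E : \int[P']_t f (bsum alpha (J ^~ t) (e' ^~ t) n) =
   \int[P']_t f (Xseq alpha (fun k => J (n - k)%N t) (fun k => e' (n.+1 - k)%N t) 0 n).
  by apply: eq_Rintegral => t _; rewrite -bsumE.
rewrite E.
apply: (chain_compare (V1 := I) (e1 := e) (V2 := fun k => J (n - k)%N)
  (e2 := fun k => e' (n.+1 - k)%N) (c := fun i => NngNum (c0 i))
  (G := fun s w => f (Xseq alpha s w 0 n))) => //.
- by move=> k B; exact: me'.
- move=> s B mB; apply: eq_trans (law n s B mB) _.
  rewrite [X in (_ * X)%E](joint_law_reversed _ pi0 law' s mB) /= -EFinM.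
  by rewrite !mulrA divfK // gt_eqF.
- move=> s; apply: measurable_cont_random_mx cf.
  apply: (@random_mx_Xseq R _ (g_sigma_algebraType (@noise_rect R r p n)) r p alpha
    (fun k _ => s k) (fun k w => w k) (fun=> 0)).
  + move=> k i; have [->|ne] := eqVneq (s k) i.
      by rewrite (_ : mkset _ = setT) //; apply/seteqP; split.
    rewrite (_ : mkset _ = set0) //; apply/seteqP; split => // w /= /eqP.
    by rewrite (negbTE ne).
  + by move=> k kn; exact: random_mx_coord.
  + exact: random_mx_cst.
- move=> s s' w ss'; congr f; apply: Xseq_ext => // k /andP[_ kn]; exact: ss'.
Qed.

(** Identical distribution moves every event to the first noise, where a finite mean makes the tails
    summable. *)
Lemma logp_col_tail_sum (R : realType) (r p : nat) d (T : measurableType d)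
    (P : probability T R) (mu : 'I_r -> R) (Q : 'M[R]_r) (nu : set 'M[R]_(p, r) -> R)
    (I : nat -> T -> 'I_r) (e : nat -> T -> 'M[R]_(p, r)) (L : R) i :
  markov_chain P mu Q I -> iid_indep_noise P I e nu -> 0 < L ->
  (\int[P]_t (logp_col i (e 1%N t))%:E < +oo)%E ->
  (\sum_(n <oo) P [set t | (n%:R * L < logp_col i (e n.+1 t))%R] < +oo)%E.
Proof.
move=> cI ie L0 fW.
have re k : random_mx (e k) by apply: borel_random_mx; exact: ie.1.
have mB c : borel_mx [set A : 'M[R]_(p, r) | c < logp_col i A].
  have mid : random_mx (fun A : g_sigma_algebraType [set U : set 'M[R]_(p, r) | open U] => A).
    by apply: borel_random_mx => B.
  have mf := measurable_logp_col i mid.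
  have := mf measurableT `]c, +oo[%classic (measurable_itv _); rewrite setTI.
  by rewrite (_ : _ @^-1` _ = [set A | c < logp_col i A]) //; apply/seteqP; split => A /=;
    rewrite in_itv /= andbT.
have E n : P [set t | (n%:R * L < logp_col i (e n.+1 t))%R] =
    P [set t | (n%:R * L < logp_col i (e 1%N t))%R].
  apply: (eq_trans (noise_law cI ie (mB (n%:R * L)) (ltn0Sn n))).
  exact: (esym (noise_law cI ie (mB (n%:R * L)) (ltn0Sn 0))).
under eq_eseriesr do rewrite E.
apply: sum_tail_fin => //; first exact: measurable_logp_col.
by move=> t; rewrite /logp_col le_max lexx orbT.
Qed.

(** * The limiting distribution *)

Section Limit.
Context {R : realType} {r p : nat}.
Variables (Q : 'M[R]_r) (alpha : 'I_r -> 'M[R]_p) (nu : set 'M[R]_(p, r) -> R).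
Variables (tau rho C : R) (pi : 'I_r -> R).
Hypothesis sQ : stochastic Q.
Hypotheses (tau01 : 0 < tau < 1) (rho01 : 0 < rho < 1) (C0 : 0 <= C).
Hypothesis tail : forall n i,
  Epath Q n i (fun s => (tau ^+ n < `|lprod alpha s|)%R%:R) <= C * rho ^+ n.
Hypotheses (statpi : stationary Q pi) (pi0 : forall i, 0 < pi i).

Lemma backward_stationary d (T : measurableType d) (P : probability T R) (mu : 'I_r -> R)
    (I : nat -> T -> 'I_r) (e : nat -> T -> 'M[R]_(p, r)) (i0 : 'I_r) :
  markov_chain P mu Q I -> iid_indep_noise P I e nu ->
  (forall i, \int[P]_t (logp_col i (e 1%N t))%:E < +oo)%E ->
  exists (d' : measure_display) (T' : measurableType d') (P' : probability T' R)
         (J : nat -> T' -> 'I_r) (e' : nat -> T' -> 'M[R]_(p, r)) (Y : T' -> 'cV[R]_p),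
    [/\ forall n i, measurable [set t | J n t = i],
        forall k B, borel_mx B -> measurable (e' k @^-1` B),
        joint_law P' pi (reversed_kernel Q pi) nu J e',
        random_mx Y &
        {ae P', forall t, bsum alpha (J ^~ t) (e' ^~ t) n @[n --> \oo] --> Y t}].
Proof.
move=> cI ie lm.
have sQt := stochastic_reversed sQ statpi pi0.
have [J cJ] := markov_chain_uniform i0 sQt statpi.1.
pose U := uniform_prob (@ltr01 R).
pose P' : probability _ R := (U \x P)%E.
pose JJ k (x : R * T) := J k x.1.
pose ee k (x : R * T) := e k x.2.
have law : joint_law P' pi (reversed_kernel Q pi) nu JJ ee.
  exact: joint_law_product cJ cI ie.
have mJJ n i : measurable [set x | JJ n x = i].
  have := @measurableX _ _ _ T _ _ (cJ.1 n i) measurableT.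
  by rewrite (_ : _ `*` _ = [set x | JJ n x = i]) //; apply/seteqP; split => x // [].
have mee k B : borel_mx B -> measurable (ee k @^-1` B).
  move=> mB; have := @measurableX _ _ (measurableTypeR R) _ _ _ measurableT (ie.1 k B mB).
  by rewrite (_ : _ `*` _ = ee k @^-1` B) //; apply/seteqP; split => x // [].
have nuT := nu_setT cI ie.
have [Y [mY cY]] : exists Y : (measurableTypeR R * T)%type -> 'cV[R]_p, random_mx Y /\
    {ae P', forall t, bsum alpha (JJ ^~ t) (ee ^~ t) n @[n --> \oo] --> Y t}.
  apply: (@backward_limit R r p _ _ P' alpha JJ ee mJJ _ tau rho C) => //.
  - by move=> k; apply: borel_random_mx; exact: mee.
  (* For fixed n, [bprod] is the forward product along the path reversed at n, which up to time n
     has the law of a stationary chain with kernel Q; the tail bound for Q therefore applies. *)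
  - move=> n; rewrite (_ : [set t | _] =
        [set t | tau ^+ n < `|mprod alpha ((fun k => JJ (n - k)%N) ^~ t) n|]); last first.
      by apply/seteqP; split => t /=; rewrite bprodE.
    apply: (mprod_tail_event (P := P') (V := fun k => JJ (n - k)%N) tail statpi.1) => [n' i|s].
      exact: mJJ.
    have := joint_law_reversed n pi0 law s (fun=> @borel_mxT _ _ _).
    rewrite [X in (_ * X)%:E]big1 ?mulr1 // => <-; congr (P' _); apply/seteqP; split => t /=.
      by move=> h; split.
    by move=> [].
  - move=> L i L0; have := logp_col_tail_sum cI ie L0 (lm i).
    apply: le_lt_trans; apply: lee_nneseries => // n _.
    have mW : measurable [set t | n%:R * L < logp_col i (e n.+1 t)].
      apply/measurable_gt/measurable_logp_col; apply: borel_random_mx; exact: ie.1.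
    rewrite (_ : mkset _ = [set: measurableTypeR R] `*` [set t | n%:R * L < logp_col i (e n.+1 t)]).
      rewrite [leLHS](product_measure1E U P) //.
      by rewrite [X in (X * _)%E](probability_setT U) mul1e.
    by apply/seteqP; split => x //= [].
by exists _, _, P', JJ, ee, Y.
Qed.

(** Three errors of eps / 3: restarting from 0 at time N, replacing the law of I_N by pi, and
    stopping the backward sum at n. N is fixed by the second one, whose bound is uniform in n; the
    other two vanish as n grows. *)
Lemma limit_law d' (T' : measurableType d') (P' : probability T' R)
    (J : nat -> T' -> 'I_r) (e' : nat -> T' -> 'M[R]_(p, r)) (Y : T' -> 'cV[R]_p) :
  (forall n i, measurable [set t | J n t = i]) ->
  (forall k B, borel_mx B -> measurable (e' k @^-1` B)) ->
  joint_law P' pi (reversed_kernel Q pi) nu J e' -> random_mx Y ->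
  {ae P', forall t, bsum alpha (J ^~ t) (e' ^~ t) n @[n --> \oo] --> Y t} ->
  (forall mu, prob_vector mu -> forall j, iter n (mstep Q) mu j @[n --> \oo] --> pi j) ->
  forall d (T : measurableType d) (P : probability T R) (mu : 'I_r -> R)
    (I : nat -> T -> 'I_r) (e : nat -> T -> 'M[R]_(p, r)) (X0 : T -> 'cV[R]_p),
  prob_vector mu -> markov_chain P mu Q I -> iid_indep_noise P I e nu -> random_mx X0 ->
  forall f : 'cV[R]_p -> R, bcont f ->
    \int[P]_t f (Xseq alpha (I ^~ t) (e ^~ t) (X0 t) n) @[n --> \oo] --> \int[P']_t f (Y t).
Proof.
move=> mJ me' law' mY cY lim d T P mu I e X0 pmu cI ie mX0.
have mI := cI.1; have me := ie.1; have nuT := nu_setT cI ie.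
have law := iid_joint_law cI ie.
have re k : random_mx (e k) by apply: borel_random_mx; exact: me.
have re' k : random_mx (e' k) by apply: borel_random_mx; exact: me'.
apply: (portmanteau_lipschitz (X := fun n t => Xseq alpha (I ^~ t) (e ^~ t) (X0 t) n)) => //.
  by move=> n; exact: random_mx_Xseq.
move=> f [M fM] [L fL]; have cf := lipschitz_continuous_mx fL.
have cZ : \int[P']_t f (bsum alpha (J ^~ t) (e' ^~ t) n) @[n --> \oo] --> \int[P']_t f (Y t).
  apply: (bounded_convergence (M := M)) => //.
  - by move=> n; apply: measurable_cont_random_mx cf; exact: random_mx_bsum.
  - exact: measurable_cont_random_mx cf.
  - apply: filterS cY => t ct; apply: continuous_cvg ct; exact: cf.
apply/cvgrPdist_le => eps eps0.
have M0 : 0 <= M by apply: le_trans (fM 0).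
(* [M *+ 2] is the factor in the comparison bound; the + 1 keeps the divisor positive when M = 0. *)
pose del := eps / 3 / (M *+ 2 + 1).
have M1 : 0 < M *+ 2 + 1 by rewrite ltr_wpDl // mulrn_wge0.
have del0 : 0 < del by rewrite /del !divr_gt0.
have delM : del * (M *+ 2) <= eps / 3.
  rewrite /del mulrAC ler_pdivrMr //; apply: ler_wpM2l; last by rewrite lerDl.
  by rewrite divr_ge0 // ltW.
have [N HN] : exists N, forall i, `|iter N (mstep Q) mu i / pi i - 1| <= del.
  have : \forall n \near \oo, forall i, `|iter n (mstep Q) mu i / pi i - 1| <= del.
    apply: filter_forall => i.
    have : iter n (mstep Q) mu i / pi i @[n --> \oo] --> pi i / pi i.
      by apply: cvgMl; exact: lim.
    rewrite divff ?gt_eqF // => /cvgrPdist_le/(_ del del0).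
    by apply: filterS => n; rewrite distrC.
  by move=> [N _ HN]; exists N; apply: HN => /=.
have lawN := joint_law_iter_shift N nuT mI me law.
have cmp n := joint_law_compare (e' := e') (f := f) (M := M) (eps := del) alpha n
  (iter_mstep_prob N sQ pmu) pi0
  (fun n => mI (N + n)%N) (fun n => me (N + n)%N) mJ me' lawN law' cf fM HN.
have e30 : 0 < eps / 3 by rewrite divr_gt0.
have fs := forget_start sQ tau01 rho01 C0 tail N pmu nuT mI me law mX0 fM fL.
have [n1 _ H1] := (cvgrPdist_le _ _).1 fs _ e30.
have [n2 _ H2] := (cvgrPdist_le _ _).1 cZ _ e30.
exists (N + maxn n1 n2)%N => // m /= Nm.
pose n := (m - N)%N.
have mE : m = (N + n)%N by rewrite /n subnKC // (leq_trans _ Nm) // leq_addr.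
have nn : (maxn n1 n2 <= n)%N by rewrite -(leq_add2l N) -mE.
have n1n : (n1 <= n)%N := leq_trans (leq_maxl _ _) nn.
have n2n : (n2 <= n)%N := leq_trans (leq_maxr _ _) nn.
have tri (a b c g : R) : `|0 - (c - g)| <= eps / 3 -> `|a - b| <= eps / 3 ->
    `|g - b| <= eps / 3 -> `|a - c| <= eps.
  rewrite sub0r normrN !ler_norml => /andP[? ?] /andP[? ?] /andP[? ?].
  by apply/andP; split; lra.
rewrite mE; exact: tri (H1 n n1n) (H2 n n2n) (le_trans (cmp n) delM).
Qed.
End Limit.

Theorem theorem1 (R : realType) (r p : nat) (Q : 'M[R]_r)
  (alpha : 'I_r -> 'M[R]_p) (nu : set 'M[R]_(p, r) -> R) (lambda : \bar R) :
  stochastic Q -> irreducible Q -> aperiodic Q ->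
  (* lambda is the top Lyapunov exponent of {A_n}, I_0 stationary *)
  (forall (d : measure_display) (T : measurableType d) (P : probability T R)
          (pi : 'I_r -> R) (I : nat -> T -> 'I_r),
     stationary Q pi -> markov_chain P pi Q I ->
     {ae P, forall t,
        (fun n : nat => (((n.+1%:R)^-1)%:E *
                         elog `|mprod alpha (fun k => I k t) n.+1|)%E)
          @ \oo --> lambda}) ->
  (lambda < 0)%E ->
  exists (d' : measure_display) (T' : measurableType d')
         (P' : probability T' R) (Y : T' -> 'cV[R]_p),
    random_mx Y /\
    forall (d : measure_display) (T : measurableType d) (P : probability T R)
           (mu0 : 'I_r -> R) (I : nat -> T -> 'I_r)
           (eps : nat -> T -> 'M[R]_(p, r)) (X0 : T -> 'cV[R]_p),
      prob_vector mu0 ->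
      markov_chain P mu0 Q I ->
      iid_indep_noise P I eps nu ->
      (* E max(log ||eps_{1i}||, 0) < oo for every regime i *)
      (forall i : 'I_r,
         (\int[P]_t (Num.max (ln `|col i (eps 1%N t)|) 0)%:E < +oo)%E) ->
      random_mx X0 ->
      forall f : 'cV[R]_p -> R, bcont f ->
        (fun n : nat =>
           Rintegral P setT (fun t => f (Xseq alpha (fun k => I k t)
                                           (fun k => eps k t) (X0 t) n)))
          @ \oo --> Rintegral P' setT (fun y => f (Y y)).
Proof.
(* If no process satisfies the hypotheses, any Y will do; otherwise one such process
   provides the noise of the backward series whose law is the limit. *)
move=> sQ irr aper lyap l0.
have [inst|ninst] := pselect (exists (d : measure_display) (T : measurableType d)
    (P : probability T R) (mu0 : 'I_r -> R) (I : nat -> T -> 'I_r)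
    (eps : nat -> T -> 'M[R]_(p, r)),
  [/\ prob_vector mu0, markov_chain P mu0 Q I, iid_indep_noise P I eps nu &
    forall i : 'I_r, (\int[P]_t (Num.max (ln `|col i (eps 1%N t)|) 0)%:E < +oo)%E]); last first.
  exists _, _, (uniform_prob (@ltr01 R)), (fun=> 0); split; first exact: random_mx_cst.
  move=> d T P mu0 I eps X0 pmu cI ie lm mX0 f bf; exfalso; apply: ninst.
  by exists d, T, P, mu0, I, eps.
have [d [T [P [mu0 [I [eps [pmu cI ie lm]]]]]]] := inst.
(* Total mass 1 rules out r = 0. *)
have [i0 _] : exists i : 'I_r, True.
  apply: contrapT => nr; have := pmu.2; rewrite big1 => [/esym/eqP|i _].
    by rewrite oner_eq0.
  by exfalso; apply: nr; exists i.
have [pi [statpi pi0 lim]] := markov_limit i0 sQ irr aper.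
(* The hypothesis on lambda speaks of all stationary chains; K is one to which it can be applied. *)
have [K cK] := markov_chain_uniform i0 sQ statpi.1.
have [c c0 Hc] := Epath_lyapunov sQ statpi.1 pi0 l0 cK (lyap _ _ _ _ _ statpi cK).
have [tau [rho [C [tau01 rho01 C0 tail]]]] := Epath_tail sQ c0 Hc.
have [d' [T' [P' [J [e' [Y [mJ me' law' mY cY]]]]]]] :=
  backward_stationary sQ tau01 rho01 C0 tail statpi pi0 i0 cI ie lm.
exists d', T', P', Y; split => // d1 T1 P1 mu1 I1 eps1 X1 pmu1 cI1 ie1 _ mX1 f bf.
exact: (limit_law sQ tau01 rho01 C0 tail pi0 mJ me' law' mY cY lim pmu1 cI1 ie1 mX1 bf).
Qed.
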